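(* For every $\alpha\in(0,1]$ there is a constant $c(\alpha)>0$ depending only on $\alpha$ such that the following holds. Let $n\ge 1$, let $\{\delta_i\}_{1\le i\le n}$ and $\{\zeta_i\}_{1\le i\le n}$ be two sequences of random variables that are independent of each other, where $\delta_1,\dots,\delta_n$ are independent with $\delta_i\sim\mathrm{Bernoulli}(p_i)$, and $\zeta_1,\dots,\zeta_n$ are independent centered $\alpha$-sub-exponential random variables. Put $\xi=(\xi_1,\dots,\xi_n)^\top$ with $\xi_i=\delta_i\zeta_i$, let $A=(a_{ij})_{n\times n}$ be a fixed real symmetric matrix, and let $L(\alpha)=\max_i\|\zeta_i\|_{\Psi_\alpha}$, assumed positive. Then for all $t\ge 0$, $$\mathbb{P}\left\{|\xi^\top A\xi-\mathbb{E}\,\xi^\top A\xi|\ge L(\alpha)^2t\right\}\le 2\exp(-c(\alpha)f(t)),$$ where $$f(t)=\min\left\{\frac{t^2}{\sum_{k}a_{kk}^2p_k+\sum_{i\ne j}a_{ij}^2p_ip_j},\ \frac{t}{\|(a_{ij}\sqrt{p_ip_j})_{n\times n}\|_{l_2\to l_2}},\ \left(\frac{t}{\max_i(\sum_ja_{ij}^2p_j)^{1/2}}\right)^{\frac{2\alpha}{2+\alpha}},\ \left(\frac{t}{\|A\|_\infty}\right)^{\frac{\alpha}{2}}\right\}.$$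
   Context: $\delta\sim\mathrm{Bernoulli}(p)$, $p\in[0,1]$, means $\delta\in\{0,1\}$ with $\mathbb{P}(\delta=1)=p$. A random variable $\eta$ is $\alpha$-sub-exponential if for some $K>0$, $\mathbb{P}\{|\eta|\ge t\}\le 2\exp(-t^\alpha/K^\alpha)$ for all $t\ge0$; its $\alpha$-sub-exponential norm is $\|\eta\|_{\Psi_\alpha}=\inf\{t>0:\mathbb{E}\exp(|\eta|^\alpha/t^\alpha)\le 2\}$. Centered means mean zero. $\|\cdot\|_{l_2\to l_2}$ is the spectral (operator) norm and $\|A\|_\infty=\max_{i,j}|a_{ij}|$ is the entrywise maximum norm. Quotients with zero denominator are read as $x/0=+\infty$ for $x>0$ and $0/0=0$. *)

(* Defs.v *)
From HB Require Import structures.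
From mathcomp Require Import all_boot all_order all_algebra.
From mathcomp Require Import all_classical all_reals all_analysis.

Set Implicit Arguments.
Unset Strict Implicit.
Unset Printing Implicit Defensive.

Import Order.TTheory GRing.Theory Num.Theory.
Import numFieldNormedType.Exports.

Local Open Scope classical_set_scope.
Local Open Scope ring_scope.

Section RandomVariables.
Context d (T : measurableType d) (R : realType) (P : probability T R).

(* The values of [X] are constrained only almost surely. *)
Definition bernoulli_rv (p : R) (X : {RV P >-> R}) : Prop :=
  [/\ 0 <= p <= 1,
      {ae P, forall w, X w = 0 \/ X w = 1} &
      P [set w | X w = 1] = p%:E].

Definition sub_exponential (alpha : R) (X : {RV P >-> R}) : Prop :=
  exists2 K : R, 0 < K &
    forall t : R, 0 <= t ->
      (P [set w | (t <= `|X w|)%R]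
       <= (2 * expR (- (t `^ alpha / K `^ alpha)))%:E)%E.

(* The infimum is taken in [R], where [inf set0 = 0]; for [alpha]-sub-exponential
   [X], [alpha > 0], the set is nonempty and bounded below by [0]. *)
Definition psi_norm (alpha : R) (X : {RV P >-> R}) : R :=
  inf [set t : R | 0 < t /\
    ('E_P[fun w => expR (`|X w| `^ alpha / t `^ alpha)] <= 2%:E)%E].

(* Subfamilies are covered by taking some of the [B i] equal to [setT]. *)
Definition mutually_independent n (X : 'I_n -> {RV P >-> R}) : Prop :=
  forall B : 'I_n -> set R, (forall i, measurable (B i)) ->
    P (\bigcap_(i in [set: 'I_n]) (X i @^-1` B i)) =
    (\prod_(i < n) P (X i @^-1` B i))%E.

Definition independent_families n m
    (X : 'I_n -> {RV P >-> R}) (Y : 'I_m -> {RV P >-> R}) : Prop :=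
  forall E F : set T,
    g_sigma_preimage (fun i => X i : T -> R) E ->
    g_sigma_preimage (fun j => Y j : T -> R) F ->
    P (E `&` F) = (P E * P F)%E.

End RandomVariables.

Section Matrices.
Context (R : realType).

Definition l2_norm n (x : 'cV[R]_n) : R := Num.sqrt (\sum_(i < n) x i 0 ^+ 2).

Definition l2_op_norm m n (M : 'M[R]_(m, n)) : R :=
  sup [set l2_norm (M *m x) | x in [set x : 'cV[R]_n | l2_norm x <= 1]].

Definition quad_form n (A : 'M[R]_n) (x : 'cV[R]_n) : R :=
  (x^T *m A *m x) 0 0.

(* Division in [\bar R] satisfies [0^-1 = +oo] and [0 * +oo = 0], so that
   [x / 0 = +oo] for [x > 0] and [0 / 0 = 0]; moreover [+oo `^ r = +oo] for
   [r != 0]. [mx_norm] is the entrywise maximum norm. *)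
Definition hanson_wright_rate n (alpha : R) (A : 'M[R]_n) (p : 'I_n -> R)
    (t : R) : \bar R :=
  let variance := \sum_(k < n) A k k ^+ 2 * p k +
    \sum_(i < n) \sum_(j < n | i != j) A i j ^+ 2 * p i * p j in
  let spectral := l2_op_norm (\matrix_(i, j) (A i j * Num.sqrt (p i * p j))) in
  let row_max :=
    \big[Num.max/0]_(i < n) Num.sqrt (\sum_(j < n) A i j ^+ 2 * p j) in
  let entry_max := mx_norm A in
  (Order.min ((t ^+ 2)%:E / variance%:E)
  (Order.min (t%:E / spectral%:E)
  (Order.min ((t%:E / row_max%:E) `^ (2 * alpha / (2 + alpha))%R)
             ((t%:E / entry_max%:E) `^ (alpha / 2)%R))))%E.

End Matrices.

(* Main.v *)
(** Write [X i] for [delta i * zeta i / L] and [beta = 1 / alpha]; then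
    [|E (X i ^ m)| <= p i * (K * m ^ beta) ^ m].  Moments of order [N] of the
    centered chaos are bounded by [(C * tau) ^ N] as soon as [tau] dominates
    [sqrt (N * variance)], [N * spectral], [N ^ (beta + 1 / 2) * row_max] and
    [N ^ (2 * beta) * entry_max]; Markov's inequality with [N] proportional to
    the rate then gives the tail.

    - The moment of order [N] of a linear form [sum_i b i * X i] is at most [C ^ N] times
      [(N * sum_i p i * b i ^ 2) ^ (N / 2) + N ^ (beta * N) * sum_i p i * b i ^ N]:
      up to order [N] its moment series is that of a sub-exponential variable of
      scale [N ^ (beta - 1)].  Both sides are polynomials in [b], so [b] may be
      random and independent of the [X i] involved.
    - Decoupling over random subsets of indices reduces the off-diagonal chaos to
      such conditional linear forms.  What remains is the moment of the energy
      [W = sum_i p i * (sum_j a i j * X j) ^ 2].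
    - [W] is again a chaos, with matrix [D = A^T * diag p * A].  Conditionally, its
      decoupled linear forms have coefficients controlled by
      [spectral ^ 2 * W] and by [row_max ^ 2 * W], so the moment of [W] is bounded by
      its own square root, and the inequality closes without any Gaussian
      comparison. *)
From HB Require Import structures.
From mathcomp Require Import all_boot all_order all_algebra.
From mathcomp Require Import ring lra.
From mathcomp Require Import all_classical all_reals all_analysis.
From mathcomp Require Import measurable_realfun.
Require Import Defs.

Set Implicit Arguments.
Unset Strict Implicit.
Unset Printing Implicit Defensive.

Import Order.TTheory GRing.Theory Num.Theory.
Import numFieldNormedType.Exports.

Local Open Scope ring_scope.

(** * Real inequalities *)

Section RealInequalities.
Context (R : realType).
Implicit Types (x y a b K : R) (m n N : nat).

(** For [alpha < 1] the variables may have no exponential moment, so there is no Laplace transform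
    to optimize; its substitute is [moment_series], cut at the very order [N] that Markov's
    inequality will use. The four conditions on [tau] are the inequality between [N] and the rate,
    solved for [t]: the exponents [beta + 1 / 2] and [2 * beta] are the inverses of
    [2 * alpha / (2 + alpha)] and [alpha / 2]. Three facts let the energy estimate close. It is made
    for the maximum over all index subsets at once, because decoupling replaces a subset by a
    smaller one. Rosenthal's inequality at order [k] returns the energy at order [k / 2], which
    Jensen's inequality turns into a square root. And the maximum is known beforehand to be finite,
    since all moments exist, so the resulting quadratic inequality can be solved. The energy is
    needed at order [N / 2], which must again be even: hence [N] is a multiple of 4. *)

Lemma exprn_le_fact_expR m : m%:R ^+ m <= m`!%:R * expR 1 ^+ m :> R.
Proof.
case: m => [|m]; first by rewrite !expr0 mulr1.
have fact_pos : 0 < (m.+1)`!%:R :> R by rewrite ltr0n fact_gt0.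
rewrite -expRM_natr mul1r mulrC -ler_pdivrMr //.
by apply: le_trans (expR_ge1Dxn m _) => //; rewrite lerDr.
Qed.

(** Follows from [ln m < m]. It absorbs every leftover power of the moment order into a constant
    raised to that order. *)
Lemma powR_natr_le_expR a m : 0 <= a -> (0 < m)%N -> m%:R `^ a <= expR a ^+ m.
Proof.
move=> a0 m0; have mR : 0 < m%:R :> R by rewrite ltr0n.
rewrite /powR gt_eqF // -expRM_natr ler_expR ler_wpM2l //.
exact/ltW/ln_sublinear.
Qed.

Lemma powR_sqr x a : (x `^ a) ^+ 2 = x `^ (2 * a).
Proof. by rewrite -powR_mulrn ?powR_ge0 // -powRrM mulrC. Qed.

Lemma fact_le_expn m : (m`! <= m ^ m)%N.
Proof.
elim: m => // m IH; rewrite factS expnS leq_mul2l /=.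
by apply: leq_trans IH _; case: m => // m; rewrite leq_exp2r.
Qed.

(* In the sum over [m], [m = 2] loses nothing and every further unit of [m]
   costs at most a factor [N `^ (beta - 1)]: up to order [N] the variable
   behaves like a sub-exponential one of that scale. *)
Lemma moment_term_le K beta m N : 0 <= K -> 1 <= beta -> (1 < m <= N)%N ->
  (K * m%:R `^ beta) ^+ m / m`!%:R <=
  (K * expR (2 * beta - 1)) ^+ m * (N%:R `^ (beta - 1)) ^+ (m - 2).
Proof.
move=> K0 beta1 /andP[m1 mN]; have m0 : (0 < m)%N by apply: ltn_trans m1.
have mR : 0 < m%:R :> R by rewrite ltr0n.
have fact_pos : 0 < m`!%:R :> R by rewrite ltr0n fact_gt0.
have -> : m%:R `^ beta = m%:R * m%:R `^ (beta - 1) :> R.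
  by rewrite mulr_powRB1 // ?ltW // (lt_le_trans ltr01).
rewrite !exprMn ler_pdivrMr // -!mulrA ler_wpM2l ?exprn_ge0 //.
(* Two of the [m] factors are absorbed into the constant, so only [m - 2] of them are allowed to
   grow with [N]. *)
have -> : (m%:R `^ (beta - 1)) ^+ m =
    (m%:R `^ (beta - 1)) ^+ 2 * (m%:R `^ (beta - 1)) ^+ (m - 2) :> R.
  by rewrite -exprD subnKC.
have -> : expR (2 * beta - 1) = expR 1 * expR (beta - 1) ^+ 2 :> R.
  by rewrite -expRM_natr -expRD; congr expR; ring.
have h1 := exprn_le_fact_expR m.
have h2 : (m%:R `^ (beta - 1)) ^+ 2 <= (expR (beta - 1) ^+ 2) ^+ m :> R.
  rewrite exprAC; apply: lerXn2r; rewrite ?nnegrE ?powR_ge0 ?exprn_ge0 ?expR_ge0 //.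
  by apply: powR_natr_le_expR => //; rewrite subr_ge0.
have h3 : (m%:R `^ (beta - 1)) ^+ (m - 2) <= (N%:R `^ (beta - 1)) ^+ (m - 2) :> R.
  apply: lerXn2r; rewrite ?nnegrE ?powR_ge0 //.
  by rewrite ge0_ler_powR ?nnegrE ?subr_ge0 // ler_nat.
rewrite [X in _ <= X](_ : _ = (m`!%:R * expR 1 ^+ m) *
   ((expR (beta - 1) ^+ 2) ^+ m * (N%:R `^ (beta - 1)) ^+ (m - 2))); last by rewrite exprMn; ring.
apply: ler_pM => //; rewrite ?mulr_ge0 ?exprn_ge0 ?powR_ge0 //.
by apply: ler_pM => //; rewrite ?exprn_ge0 ?powR_ge0.
Qed.

Lemma exprn_le_1D x m n : 0 <= x -> (m <= n)%N -> x ^+ m <= 1 + x ^+ n.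
Proof.
move=> x0 mn; have [x1|x1] := lerP x 1.
  by rewrite (le_trans (exprn_ile1 _ _ _)) // lerDl exprn_ge0.
by rewrite (le_trans (ler_weXn2l _ mn)) ?ltW // ltrDr.
Qed.

Lemma geometric_half_le n : \sum_(0 <= l < n) 2^-1 ^+ l <= 2 :> R.
Proof.
suff -> : \sum_(0 <= l < n) 2^-1 ^+ l = 2 - 2 * 2^-1 ^+ n :> R.
  by rewrite lerBlDr lerDl mulr_ge0 ?exprn_ge0 // invr_ge0.
elim: n => [|n IH]; first by rewrite big_nil expr0; lra.
by rewrite big_nat_recr //= IH exprS; field.
Qed.

(** Intermediate orders are dominated by the extreme ones, since
    [(x * s) ^+ l <= 1 + (x * s) ^+ (N - 2)], and the halves make the sum bounded uniformly in [N].
    This is why only the orders [2] and [N] survive in [rosenthal]. *)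
Lemma geometric_sum_le x s N : 0 <= x -> 0 <= s -> (1 < N)%N ->
  \sum_(2 <= m < N.+1) (x / 2) ^+ m * s ^+ (m - 2) <=
  2^-1 * (x ^+ 2 + x ^+ N * s ^+ (N - 2)).
Proof.
move=> x0 s0 N1.
have -> : 2^-1 * (x ^+ 2 + x ^+ N * s ^+ (N - 2)) =
    (x ^+ 2 / 4 * (1 + (x * s) ^+ (N - 2))) * 2.
  have -> : x ^+ N = x ^+ 2 * x ^+ (N - 2) by rewrite -exprD subnKC.
  by rewrite exprMn; field.
apply: (@le_trans _ _ ((x ^+ 2 / 4 * (1 + (x * s) ^+ (N - 2))) *
    \sum_(0 <= l < N.+1 - 2) 2^-1 ^+ l)); last first.
  rewrite ler_wpM2l ?geometric_half_le // mulr_ge0 ?divr_ge0 ?exprn_ge0 //.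
  by rewrite addr_ge0 ?exprn_ge0 ?mulr_ge0.
rewrite (big_addn 0 N.+1 2) mulr_sumr; apply: ler_sum_nat => l /andP[_ lN].
have -> : (x / 2) ^+ (l + 2) * s ^+ (l + 2 - 2) =
    x ^+ 2 / 4 * (x * s) ^+ l * 2^-1 ^+ l.
  by rewrite addnK exprD !exprMn; move: (2^-1 ^+ l) => h; field.
rewrite ler_wpM2r ?exprn_ge0 ?invr_ge0 // ler_wpM2l ?divr_ge0 ?exprn_ge0 //.
by apply: exprn_le_1D; rewrite ?mulr_ge0 // -ltnS -subSn.
Qed.

End RealInequalities.

(** * Convexity, sums of powers and the Cauchy-Schwarz inequality *)

Section PowerSums.
Context (R : realType).
Implicit Types (x y a z B : R) (m n N k : nat).

(** The tangent form of convexity: summed with [a] the mean of the [z i], its linear terms cancel,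
    which gives [power_mean]. *)
Lemma tangent_exprn_le z a m : 0 <= z -> 0 <= a ->
  a ^+ m.+1 + m.+1%:R * a ^+ m * (z - a) <= z ^+ m.+1.
Proof.
move=> z0 a0; elim: m => [|m IH]; first by rewrite !expr1 expr0; lra.
rewrite [leRHS]exprS; apply: le_trans (ler_wpM2l z0 IH).
rewrite -subr_ge0 [leRHS](_ : _ = m.+1%:R * a ^+ m * (z - a) ^+ 2).
  by apply: mulr_ge0; [rewrite mulr_ge0 ?exprn_ge0|rewrite exprn_even_ge0].
by rewrite -[m.+2%:R]natr1 !exprS; ring.
Qed.

Lemma power_mean (I : finType) (z : I -> R) N : (0 < #|I|)%N -> ~~ odd N ->
  (0 < N)%N ->
  (\sum_i z i) ^+ N <= #|I|%:R ^+ N.-1 * \sum_i z i ^+ N.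
Proof.
move=> I0 oddN; case: N oddN => // N oddN _; set n := #|I|%:R.
have n0 : 0 < n :> R by rewrite ltr0n.
have normE x : x ^+ N.+1 = `|x| ^+ N.+1.
  by rewrite -normrX ger0_norm // exprn_even_ge0.
pose a := (\sum_i `|z i|) / n.
have a0 : 0 <= a by rewrite divr_ge0 ?sumr_ge0 // ltW.
apply: (@le_trans _ _ (n ^+ N.+1 * a ^+ N.+1)).
  rewrite -exprMn /a mulrC divfK ?gt_eqF // normE.
  by apply: lerXn2r; rewrite ?nnegrE ?sumr_ge0 //; exact: ler_norm_sum.
rewrite exprS [n * _]mulrC -mulrA ler_wpM2l ?exprn_ge0 ?(ltW n0) //.
apply: (@le_trans _ _ (\sum_i (a ^+ N.+1 + N.+1%:R * a ^+ N * (`|z i| - a)))).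
  rewrite big_split /= -mulr_sumr sumrB !sumr_const -![a *+ _]mulr_natl.
  rewrite -[a ^+ _ *+ _]mulr_natl -/n /a [n * _ in X in _ - X]mulrC.
  by rewrite divfK ?gt_eqF // subrr mulr0 addr0.
by apply: ler_sum => i _; rewrite normE tangent_exprn_le.
Qed.

Lemma exprnD_even_le x y N : ~~ odd N -> (0 < N)%N ->
  (x + y) ^+ N <= 2 ^+ N * (x ^+ N + y ^+ N).
Proof.
move=> oddN N0.
have := @power_mean bool (fun b => if b then x else y) N.
rewrite card_bool !big_bool => /(_ isT oddN N0) /le_trans; apply.
rewrite ler_wpM2r ?addr_ge0 ?exprn_even_ge0 //.
by rewrite ler_weXn2l ?leq_pred ?ler1n.
Qed.

(** Used to merge separate bounds [C1 ^+ N + C2 ^+ N] into one [(C1 + C2) ^+ N]. *)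
Lemma exprnD_ge x y N : 0 <= x -> 0 <= y -> (0 < N)%N ->
  x ^+ N + y ^+ N <= (x + y) ^+ N.
Proof.
move=> x0 y0; elim: N => // -[|N] IH _; first by rewrite !expr1.
rewrite [leRHS]exprS; apply: le_trans (ler_wpM2l (addr_ge0 x0 y0) (IH isT)).
rewrite [x ^+ _]exprS [y ^+ _]exprS mulrDl !mulrDr.
rewrite lerD // ?lerDl ?lerDr ?mulr_ge0 ?exprn_ge0 //.
Qed.

Lemma sum_exprn_le (I : finType) (p y : I -> R) B m : (forall i, 0 <= p i) ->
  (forall i, 0 <= y i <= B) ->
  \sum_i p i * y i ^+ m.+1 <= B ^+ m * \sum_i p i * y i.
Proof.
move=> p0 yB; rewrite mulr_sumr; apply: ler_sum => i _.
have /andP[y0 yiB] := yB i.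
rewrite exprSr mulrA [leRHS]mulrCA -mulrA ler_wpM2l // ler_wpM2r //.
by apply: lerXn2r; rewrite ?nnegrE // (le_trans y0).
Qed.

(** All factors but one are replaced by the uniform bound [B]; the last is summed and gives [V]. A
    bound on a maximum and one on a total thus control a sum of powers at the cost of a single stray
    [s]. *)
Lemma scaled_sum_exprn_le (I : finType) (p y : I -> R) s B V m :
  (forall i, 0 <= p i) -> (forall i, 0 <= y i) -> 0 <= s -> 0 <= B ->
  (forall i, s * y i <= B) -> \sum_i p i * y i <= V ->
  s ^+ m.+1 * (\sum_i p i * y i ^+ m.+1) <= s * V * B ^+ m.
Proof.
move=> p0 y0 s0 B0 yB yV.
rewrite mulr_sumr (eq_bigr (fun i => p i * (s * y i) ^+ m.+1)); last first.
  by move=> i _; rewrite exprMn mulrCA.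
apply: (@le_trans _ _ (B ^+ m * \sum_i p i * (s * y i))).
  by apply: sum_exprn_le => // i; rewrite mulr_ge0 //=.
rewrite mulrC ler_wpM2r ?exprn_ge0 //.
rewrite (eq_bigr (fun i => s * (p i * y i))) => [|i _]; last by rewrite mulrCA.
by rewrite -mulr_sumr ler_wpM2l.
Qed.

(** The linear term is absorbed by [2 * B * g * z <= (B * g) ^+ 2 + z ^+ 2]. In [energy_le], [z] is
    the square root of the unknown moment. *)
Lemma quadratic_bound A B g z : 0 <= g -> 0 <= z ->
  z ^+ 2 <= A * g ^+ 2 + B * g * z -> z ^+ 2 <= (2 * A + B ^+ 2) * g ^+ 2.
Proof.
move=> g0 z0 h; have : 0 <= (B * g - z) ^+ 2 by rewrite exprn_even_ge0.
by nra.
Qed.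

Lemma weighted_CS (I : finType) (p u v : I -> R) : (forall i, 0 <= p i) ->
  (\sum_i p i * u i * v i) ^+ 2 <=
  (\sum_i p i * u i ^+ 2) * (\sum_i p i * v i ^+ 2).
Proof.
move=> p0; set a := \sum_i p i * u i * v i; set uu := \sum_i p i * u i ^+ 2.
set vv := \sum_i _.
have h s t : 0 <= s ^+ 2 * uu - 2 * s * t * a + t ^+ 2 * vv.
  have -> : s ^+ 2 * uu - 2 * s * t * a + t ^+ 2 * vv =
      \sum_i p i * (s * u i - t * v i) ^+ 2.
    rewrite /uu /a /vv !mulr_sumr -sumrB -big_split /=.
    by apply: eq_bigr => i _; ring.
  by apply: sumr_ge0 => i _; rewrite mulr_ge0 // exprn_even_ge0.
have uu0 : 0 <= uu by apply: sumr_ge0 => i _; rewrite mulr_ge0 // exprn_even_ge0.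
have vv0 : 0 <= vv by apply: sumr_ge0 => i _; rewrite mulr_ge0 // exprn_even_ge0.
(* At [(vv, a)] the form equals [vv * (uu * vv - a ^+ 2)]. Vanishing weights can make [vv] or both
   sums zero; then other points of the form force [a = 0]. *)
have [vvp|] := ltrP 0 vv; first by have := h vv a; nra.
move=> vv_le; have {}vv0 : vv = 0 by apply/le_anti/andP.
have [uup|] := ltrP 0 uu; first by have := h a uu; rewrite vv0; nra.
move=> uu_le; have {}uu0 : uu = 0 by apply/le_anti/andP.
by have := h a 1; have := h a (-1); rewrite vv0 uu0; nra.
Qed.

End PowerSums.

(** * Moments of families in a ring of random variables *)

(* [AA] stands for a ring of random variables having all moments, [ev] for
   evaluation at an outcome and [io] for the constants; keeping it abstract makes
   [E] a total additive map, without integrability side conditions. *)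
Section Expectation.
Context (R : realType) (Omega : Type) (AA : comNzRingType)
  (ev : Omega -> {rmorphism AA -> R}) (io : {rmorphism R -> AA})
  (E : {additive AA -> R}).
Hypothesis ev_io : forall w c, ev w (io c) = c.
Hypothesis E_io : forall c x, E (io c * x) = c * E x.
Hypothesis E1 : E 1 = 1.
Hypothesis E_pos : forall x, (forall w, 0 <= ev w x) -> 0 <= E x.

(** * Independence at the level of moments and polynomials *)

Section Independence.
Context (I : finType).
Implicit Types (X : I -> AA) (J K : {set I}) (u v : AA).

(* Only moments are required to factorize, and this is all the proof uses of
   independence. *)
Definition moment_independent X := forall m : I -> nat,
  E (\prod_i X i ^+ m i) = \prod_i E (X i ^+ m i).

(** Membership in the subring generated by the constants and the [X i] with [i \in J]. The witness
    is a list of monomials, coefficient and exponents, so that [moment_independent] applies to each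
    of them. *)
Definition poly_in X J u := exists2 s : seq (R * (I -> nat)),
  forall cm, List.In cm s -> forall i, i \notin J -> cm.2 i = 0%N
  & u = \sum_(cm <- s) io cm.1 * \prod_i X i ^+ cm.2 i.

Lemma poly_in_sub X J K u : J \subset K -> poly_in X J u -> poly_in X K u.
Proof.
move=> /fintype.subsetP JK [s sJ ->]; exists s => // cm cms i iK.
by apply: (sJ cm cms i); apply: contra iK; apply: JK.
Qed.

Lemma poly_in_cst X J c : poly_in X J (io c).
Proof.
exists [:: (c, fun=> 0%N)] => [cm [<- //|//]|].
by rewrite big_seq1 big1 ?mulr1.
Qed.

Lemma poly_in_gen X J i : i \in J -> poly_in X J (X i).
Proof.
move=> iJ; exists [:: (1, fun j => (j == i) : nat)] => [cm [<- /= j|//]|].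
  by apply: contraNeq; rewrite eqb0 negbK => /eqP ->.
rewrite big_seq1 rmorph1 mul1r (bigD1 i) //= eqxx expr1 big1 ?mulr1 //.
by move=> j /negbTE ->.
Qed.

Lemma poly_inD X J u v : poly_in X J u -> poly_in X J v -> poly_in X J (u + v).
Proof.
move=> [s sJ ->] [t tJ ->]; exists (s ++ t); last by rewrite big_cat.
by move=> cm /(@List.in_app_or _ s t cm)[] cmi; [exact: (sJ cm) | exact: (tJ cm)].
Qed.

Lemma poly_inM X J u v : poly_in X J u -> poly_in X J v -> poly_in X J (u * v).
Proof.
move=> [s sJ ->] [t tJ ->].
exists (List.flat_map (fun a => List.map
  (fun b => (a.1 * b.1, fun i => (a.2 i + b.2 i)%N)) t) s).
  move=> cm /List.in_flat_map[a [/sJ aJ /List.in_map_iff[b [<- /tJ bJ]]]] i iJ /=.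
  by rewrite aJ // bJ.
elim: s {sJ} => [|a s IH]; first by rewrite !big_nil mul0r.
rewrite big_cons /= big_cat /= mulrDl -IH; congr (_ + _).
elim: t {tJ IH} => [|b t IH]; first by rewrite !big_nil mulr0.
rewrite !big_cons mulrDr IH; congr (_ + _) => /=.
rewrite rmorphM mulrACA -big_split /=; congr (_ * _).
by apply: eq_bigr => i _; rewrite exprD.
Qed.

Lemma poly_in_sum X J (r : seq I) (P : pred I) (F : I -> AA) :
  (forall i, P i -> poly_in X J (F i)) -> poly_in X J (\sum_(i <- r | P i) F i).
Proof.
move=> PF; elim/big_ind: _ => //; last by move=> *; apply: poly_inD.
by rewrite -(rmorph0 io); apply: poly_in_cst.
Qed.

Lemma poly_in_prod X J (I' : Type) (r : seq I') (P : pred I') (F : I' -> AA) :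
  (forall i, P i -> poly_in X J (F i)) -> poly_in X J (\prod_(i <- r | P i) F i).
Proof.
move=> PF; elim/big_ind: _ => //; last by move=> *; apply: poly_inM.
by rewrite -(rmorph1 io); apply: poly_in_cst.
Qed.

Lemma poly_inX X J u m : poly_in X J u -> poly_in X J (u ^+ m).
Proof.
move=> uJ; rewrite -(card_ord m) -prodr_const; exact: poly_in_prod.
Qed.

(** Bilinearity reduces to two monomials; by disjointness one of their exponents vanishes at every
    index, where it contributes [E 1 = 1]. *)
Lemma moment_independentM X J K u v : moment_independent X ->
  [disjoint J & K] -> poly_in X J u -> poly_in X K v -> E (u * v) = E u * E v.
Proof.
move=> Xind JK [s sJ ->] [t tK ->].
elim: s sJ => [|a s IH] sJ; first by rewrite big_nil mul0r raddf0 mul0r.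
rewrite big_cons mulrDl !raddfD mulrDl IH; last first.
  by move=> cm cms; apply: (sJ cm); right.
congr (_ + _) => /=.
elim: t tK {IH} => [|b t IH] tK; first by rewrite big_nil mulr0 raddf0 mulr0.
rewrite big_cons mulrDr !raddfD mulrDr IH; last first.
  by move=> cm cmt; apply: (tK cm); right.
congr (_ + _) => /=.
rewrite mulrACA -rmorphM !E_io mulrACA; congr (_ * _).
rewrite -big_split /=.
under eq_bigr do rewrite -exprD.
rewrite !Xind -big_split /=; apply: eq_bigr => i _.
have [iJ|iJ] := boolP (i \in J).
  by rewrite (tK b) ?addn0 ?expr0 ?E1 ?mulr1 //; [left|rewrite (disjointFr JK iJ)].
by rewrite (sJ a) ?add0n ?expr0 ?E1 ?mul1r //; left.
Qed.

Lemma moment_independent_prod X (U : I -> AA) : moment_independent X ->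
  (forall i, poly_in X [set i] (U i)) -> E (\prod_i U i) = \prod_i E (U i).
Proof.
move=> Xind XU; rewrite -[RHS]big_enum -[X in E X]big_enum /=.
elim: (enum I) (enum_uniq I) => [|i r IH] /=; first by rewrite !big_nil E1.
move=> /andP[ir /IH{}IH]; rewrite !big_cons -IH.
apply: (moment_independentM (J := [set i]) (K := [set j in r])) => //.
  by rewrite disjoints1 inE.
rewrite big_seq; apply: poly_in_prod => j jr.
by apply: poly_in_sub (XU j); rewrite finset.sub1set inE.
Qed.

End Independence.

(** * Truncated exponential moment series *)

Section MomentSeries.
Implicit Types (u v : AA) (lam : R).

(** A truncated moment generating function: finite even if [exp (lam * u)] is not integrable. The
    absolute values make all terms nonnegative, which submultiplicativity under truncation relies
    on. *)
Definition moment_series N lam u : R :=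
  \sum_(0 <= m < N.+1) lam ^+ m * `|E (u ^+ m)| / m`!%:R.

Lemma moment_series_ge0 N lam u : 0 <= lam -> 0 <= moment_series N lam u.
Proof.
by move=> lam0; apply: sumr_ge0 => m _; rewrite divr_ge0 // mulr_ge0 // exprn_ge0.
Qed.

(** The binomial formula bounds the terms for [u + v] by the convolution of those for [u] and [v].
    The product of the truncated series contains every pair of total order at most [N], and its
    other pairs are nonnegative. *)
Lemma moment_seriesD N lam u v : 0 <= lam ->
  (forall a b, E (u ^+ a * v ^+ b) = E (u ^+ a) * E (v ^+ b)) ->
  moment_series N lam (u + v) <= moment_series N lam u * moment_series N lam v.
Proof.
move=> lam0 uv; pose f w m := lam ^+ m * `|E (w ^+ m)| / m`!%:R.
have f0 w m : 0 <= f w m by rewrite divr_ge0 // mulr_ge0 // exprn_ge0.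
have binom m : f (u + v) m <= \sum_(0 <= i < m.+1) f u (m - i)%N * f v i.
  rewrite {1}/f -mulrA mulrC exprDn raddf_sum.
  apply: (@le_trans _ _ ((\sum_(i < m.+1)
      `|E ((u ^+ (m - i) * v ^+ i) *+ 'C(m, i))|) / m`!%:R * lam ^+ m)).
    by rewrite ler_wpM2r ?exprn_ge0 // ler_wpM2r ?invr_ge0 // ler_norm_sum.
  rewrite big_mkord !mulr_suml; apply: ler_sum => i _.
  have im : (i <= m)%N by rewrite -ltnS.
  rewrite raddfMn uv normrMn normrM -mulr_natr.
  have -> : m`!%:R = 'C(m, i)%:R * i`!%:R * (m - i)`!%:R :> R.
    by rewrite -!natrM -mulnA bin_fact.
  have -> : lam ^+ m = lam ^+ i * lam ^+ (m - i) by rewrite -exprD subnKC.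
  have c0 : 'C(m, i)%:R != 0 :> R by rewrite pnatr_eq0 -lt0n bin_gt0.
  have i0 : i`!%:R != 0 :> R by rewrite pnatr_eq0 -lt0n fact_gt0.
  have m0 : (m - i)`!%:R != 0 :> R by rewrite pnatr_eq0 -lt0n fact_gt0.
  rewrite le_eqVlt /f; apply/orP; left; by apply/eqP; field; rewrite c0 i0 m0.
change (\sum_(0 <= m < N.+1) f (u + v) m <=
  (\sum_(0 <= m < N.+1) f u m) * (\sum_(0 <= m < N.+1) f v m)).
apply: (@le_trans _ _ (\sum_(0 <= m < N.+1)
    \sum_(0 <= i < N.+1 | (i <= m)%N) f u (m - i)%N * f v i)).
  apply: ler_sum_nat => m /andP[_ mN]; apply: le_trans (binom m) _.
  by rewrite (big_nat_widen 0 m.+1 N.+1).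
rewrite (exchange_big_dep_nat predT) //= mulr_sumr; apply: ler_sum_nat => i /andP[_ iN].
rewrite -mulr_suml ler_wpM2r //.
rewrite -(big_nat_widenl i 0 N.+1 predT) // -{1}[i]add0n big_addn.
under eq_bigr do rewrite addnK.
rewrite (big_cat_nat (n := N.+1 - i) (p := N.+1)) ?leq_subr //=.
by rewrite lerDl sumr_ge0.
Qed.

Lemma moment_series_sum (I : finType) (X : I -> AA) (U : I -> AA) N lam
    (r : seq I) : 0 <= lam -> moment_independent X ->
  (forall i, poly_in X [set i] (U i)) -> uniq r ->
  moment_series N lam (\sum_(i <- r) U i) <=
  \prod_(i <- r) moment_series N lam (U i).
Proof.
move=> lam0 Xind XU; elim: r => [|i r IH] /=.
  rewrite !big_nil /moment_series big_nat_recl // fact0 !expr0 mul1r E1 normr1.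
  rewrite big1_seq ?addr0 ?divr1 // => m _.
  by rewrite expr0n raddf0 normr0 mulr0 mul0r.
move=> /andP[ir ur]; rewrite !big_cons.
apply: le_trans (ler_wpM2l (moment_series_ge0 N (U i) lam0) (IH ur)).
apply: moment_seriesD => // a b.
apply: (moment_independentM (J := [set i]) (K := [set j in r])) Xind _ _ _.
- by rewrite disjoints1 inE.
- exact: poly_inX.
- apply: poly_inX; rewrite big_seq; apply: poly_in_sum => j jr.
  by apply: poly_in_sub (XU j); rewrite finset.sub1set inE.
Qed.

End MomentSeries.

(** * A Rosenthal inequality for sparse heavy-tailed sums *)

Section Rosenthal.
Context (I : finType).
Implicit Types (X : I -> AA) (p b : I -> R) (K beta : R).

Definition moment_bound X p K beta := forall i, E (X i) = 0 /\
  forall m, (1 < m)%N -> `|E (X i ^+ m)| <= p i * (K * m%:R `^ beta) ^+ m.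

Definition weighted_moment p b m := \sum_i p i * b i ^+ m.

(** Centering kills the term of order 1, the factor [2] in the argument of the series provides the
    halves of [geometric_sum_le], and [1 + x <= expR x] prepares the product over [i]. *)
Lemma moment_series_le X p K beta b N i (Lam : R) : (forall i, 0 <= p i) -> 0 < K ->
  1 <= beta -> (1 < N)%N -> ~~ odd N -> moment_bound X p K beta -> 0 < Lam ->
  moment_series N (2 * (K * expR (2 * beta - 1)) * Lam)^-1 (io (b i) * X i) <=
  expR (2^-1 * (p i * b i ^+ 2 / Lam ^+ 2 +
    p i * b i ^+ N / Lam ^+ N * (N%:R `^ (beta - 1)) ^+ (N - 2))).
Proof.
move=> p0 K0 beta1 N1 oddN /(_ i)[Xi0 Xm] Lam0.
set s := N%:R `^ _; set K1 := K * _; set lam := (2 * K1 * Lam)^-1.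
have K10 : 0 < K1 by rewrite mulr_gt0 ?expR_gt0.
have lam0 : 0 < lam by rewrite invr_gt0 !mulr_gt0 ?expR_gt0 ?ltr0n.
pose x := `|b i| / Lam.
have x0 : 0 <= x by rewrite divr_ge0 // ltW.
apply: le_trans (expR_ge1Dx _).
have Elin m : E ((io (b i) * X i) ^+ m) = b i ^+ m * E (X i ^+ m).
  by rewrite exprMn -rmorphXn E_io.
rewrite /moment_series big_ltn // big_ltn ?ltnS ?(ltn_trans _ N1) //.
rewrite expr0 !Elin !expr0 !expr1 E1 Xi0 mulr0 normr0 mulr0 mul0r add0r.
rewrite !mulr1 normr1 mulr1 fact0 divr1 lerD2l.
apply: (@le_trans _ _ (p i * \sum_(2 <= m < N.+1) (x / 2) ^+ m * s ^+ (m - 2))).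
  rewrite mulr_sumr; apply: ler_sum_nat => m /andP[m2 mN].
  rewrite Elin normrM normrX.
  apply: (@le_trans _ _ (lam ^+ m * (`|b i| ^+ m *
      (p i * (K * m%:R `^ beta) ^+ m)) / m`!%:R)).
    rewrite ler_wpM2r ?invr_ge0 // ler_wpM2l ?exprn_ge0 ?(ltW lam0) //.
    by rewrite ler_wpM2l ?exprn_ge0 //; apply: Xm.
  rewrite [leLHS](_ : _ = lam ^+ m * `|b i| ^+ m * p i *
    ((K * m%:R `^ beta) ^+ m / m`!%:R)); last by ring.
  apply: (@le_trans _ _ (lam ^+ m * `|b i| ^+ m * p i *
      (K1 ^+ m * s ^+ (m - 2)))).
    rewrite ler_wpM2l ?moment_term_le ?(ltW K0) ?m2 //.
    by rewrite !mulr_ge0 ?exprn_ge0 ?(ltW lam0).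
  rewrite [leLHS](_ : _ = p i * ((lam * `|b i| * K1) ^+ m * s ^+ (m - 2))).
    by rewrite (_ : lam * `|b i| * K1 = x / 2) // /lam /x; field; rewrite !gt_eqF.
  by rewrite !exprMn; ring.
apply: le_trans (ler_wpM2l (p0 i) (geometric_sum_le x0 (powR_ge0 _ _) N1)) _.
rewrite le_eqVlt; apply/orP; left; apply/eqP.
rewrite /x !exprMn !exprVn -[_ ^+ N]normrX -[`|b i| ^+ 2]normrX.
by rewrite !ger0_norm ?exprn_even_ge0 //; ring.
Qed.

(** A Chernoff argument at finite order. The two conditions on [Lam] bound the exponent of the
    product of series by [(N + 1) / 2 <= N]; the moment of order [N] is then read off the last term
    of the series, with the factorial bounded by [N ^ N]. *)
Lemma rosenthal_scale X p K beta b N (Lam : R) : (forall i, 0 <= p i) -> 0 < K ->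
  1 <= beta -> (1 < N)%N -> ~~ odd N -> moment_independent X ->
  moment_bound X p K beta -> 0 < Lam ->
  weighted_moment p b 2 <= N%:R * Lam ^+ 2 ->
  (N%:R `^ (beta - 1)) ^+ N * weighted_moment p b N <= Lam ^+ N ->
  E ((\sum_i io (b i) * X i) ^+ N) <=
  (2 * expR 1 * (K * expR (2 * beta - 1)) * N%:R * Lam) ^+ N.
Proof.
move=> p0 K0 beta1 N1 oddN Xind Xb Lam0 T2 TN.
set K1 := K * _; set lam := (2 * K1 * Lam)^-1.
have K10 : 0 < K1 by rewrite mulr_gt0 ?expR_gt0.
have lam0 : 0 < lam by rewrite invr_gt0 !mulr_gt0 ?expR_gt0 ?ltr0n.
set Y := \sum_i _.
have NR : 1 <= N%:R :> R by rewrite ler1n (ltn_trans _ N1).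
have s1 : 1 <= N%:R `^ (beta - 1) :> R.
  apply: (@le_trans _ _ (1 `^ (beta - 1))); first by rewrite powR1.
  by rewrite ge0_ler_powR ?nnegrE ?subr_ge0.
have TN0 : 0 <= weighted_moment p b N.
  by apply: sumr_ge0 => i _; rewrite mulr_ge0 ?exprn_even_ge0.
have series : moment_series N lam Y <= expR N%:R.
  rewrite /Y -big_enum /=.
  apply: le_trans (moment_series_sum N (r := enum I) (ltW lam0) Xind _ _) _.
  - by move=> i; apply: poly_inM; [apply: poly_in_cst|apply: poly_in_gen; rewrite inE].
  - exact: enum_uniq.
  apply: (@le_trans _ _ (\prod_(i <- enum I) expR (2^-1 * (p i * b i ^+ 2 / Lam ^+ 2 +
    p i * b i ^+ N / Lam ^+ N * (N%:R `^ (beta - 1)) ^+ (N - 2))))).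
    apply: ler_prod => i _; rewrite moment_series_ge0 ?(ltW lam0) //=.
    exact: moment_series_le.
  rewrite -expR_sum ler_expR big_enum /= -mulr_sumr big_split /= -!mulr_suml.
  apply: (@le_trans _ _ (2^-1 * (N%:R + 1))); last by lra.
  rewrite ler_wpM2l ?invr_ge0 // lerD //.
    by rewrite ler_pdivrMr // exprn_gt0.
  rewrite mulrAC ler_pdivrMr ?exprn_gt0 // mul1r mulrC.
  apply: le_trans TN; rewrite ler_wpM2r //.
  by rewrite ler_weXn2l // leq_subr.
have last : lam ^+ N * `|E (Y ^+ N)| / N`!%:R <= moment_series N lam Y.
  rewrite /moment_series big_nat_recr //= lerDr sumr_ge0 // => m _.
  by rewrite divr_ge0 // mulr_ge0 // exprn_ge0 // ltW.
have {last series} := le_trans last series.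
rewrite ler_pdivrMr ?ltr0n ?fact_gt0 // -ler_pdivlMl ?exprn_gt0 // => h.
apply: le_trans (ler_norm _) (le_trans h _).
rewrite (_ : 2 * _ * K1 * _ * Lam = lam^-1 * (expR 1 * N%:R)); last first.
  by rewrite /lam invrK; ring.
have li0 : 0 <= lam^-1 by rewrite invr_ge0; exact: ltW lam0.
rewrite exprMn -exprVn ler_wpM2l ?exprn_ge0 //.
rewrite exprMn -expRM_natr mul1r ler_wpM2l ?expR_ge0 //.
by rewrite -natrX ler_nat fact_le_expn.
Qed.

Definition rosenthal_constant K beta : R :=
  2 * expR 1 * (K * expR (2 * beta - 1)).

Lemma rosenthal X p K beta b N : (forall i, 0 <= p i) -> 0 < K ->
  1 <= beta -> (1 < N)%N -> ~~ odd N -> moment_independent X ->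
  moment_bound X p K beta ->
  E ((\sum_i io (b i) * X i) ^+ N) <=
  rosenthal_constant K beta ^+ N *
    ((N%:R * weighted_moment p b 2) ^+ N./2 +
     (N%:R `^ beta) ^+ N * weighted_moment p b N).
Proof.
move=> p0 K0 beta1 N1 oddN Xind Xb.
have NR : 0 < N%:R :> R by rewrite ltr0n (ltn_trans _ N1).
have N2 : N./2.*2 = N by rewrite even_halfK.
have T20 : 0 <= weighted_moment p b 2.
  by apply: sumr_ge0 => i _; rewrite mulr_ge0 ?exprn_even_ge0.
have TN0 : 0 <= weighted_moment p b N.
  by apply: sumr_ge0 => i _; rewrite mulr_ge0 ?exprn_even_ge0.
rewrite /rosenthal_constant; set C := 2 * _ * _; pose H := (weighted_moment p b 2 / N%:R) ^+ N./2 +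
  (N%:R `^ (beta - 1)) ^+ N * weighted_moment p b N.
have C0 : 0 < C by rewrite !mulr_gt0 ?expR_gt0 ?ltr0n.
have a0 : 0 <= (weighted_moment p b 2 / N%:R) ^+ N./2.
  by rewrite exprn_ge0 // divr_ge0 // ltW.
have b0 : 0 <= (N%:R `^ (beta - 1)) ^+ N * weighted_moment p b N.
  by rewrite mulr_ge0 ?exprn_ge0 ?powR_ge0.
have H0 : 0 <= H by rewrite addr_ge0.
suff : E ((\sum_i io (b i) * X i) ^+ N) <= (C * N%:R) ^+ N * H.
  move=> /le_trans; apply.
  rewrite exprMn -mulrA ler_wpM2l ?exprn_ge0 ?(ltW C0) // mulrDr lerD //.
    have -> : N%:R ^+ N = (N%:R ^+ 2) ^+ N./2 :> R by rewrite -exprM mul2n N2.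
    rewrite -exprMn.
    by rewrite (_ : N%:R ^+ 2 * _ = N%:R * weighted_moment p b 2) //; field; rewrite gt_eqF.
  rewrite mulrA ler_wpM2r // -exprMn mulr_powRB1 ?(ltW NR) //.
  exact: lt_le_trans beta1.
have CN0 : 0 < (C * N%:R) ^+ N by rewrite exprn_gt0 // mulr_gt0.
(* [Lam ^+ N = H + eps] meets both conditions of [rosenthal_scale]; [eps] keeps [Lam] positive when
   [H = 0], for instance when [b] vanishes. *)
rewrite -ler_pdivrMl //; apply/ler_addgt0Pr => eps eps0.
pose Lam := (H + eps) `^ (N%:R^-1).
have He : 0 < H + eps by rewrite ltr_wpDl.
have LamN : Lam ^+ N = H + eps.
  by rewrite -powR_mulrn ?powR_ge0 // -powRrM mulVf ?gt_eqF // powRr1 // ltW.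
have Lam0 : 0 < Lam by rewrite powR_gt0.
rewrite ler_pdivrMl // -LamN -exprMn.
apply: rosenthal_scale => //; last first.
  by rewrite LamN /H -addrA addrCA lerDl addr_ge0 // ltW.
rewrite -ler_pdivrMl // mulrC.
rewrite -(@ler_pXn2r _ N./2) ?nnegrE ?exprn_ge0 ?divr_ge0 ?(ltW NR) ?(ltW Lam0) //; last first.
  by rewrite half_gt0.
by rewrite -exprM mul2n N2 LamN /H -addrA lerDl addr_ge0 // ltW.
Qed.

End Rosenthal.

Lemma E_le x y : (forall w, ev w x <= ev w y) -> E x <= E y.
Proof.
by move=> xy; rewrite -subr_ge0 -raddfB E_pos // => w; rewrite rmorphB subr_ge0.
Qed.

(** * Linear forms with independent random coefficients *)

Section Conditioning.
Context (I : finType).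
Implicit Types (X b : I -> AA) (J K : {set I}).

(** [h] is the conditional expectation given [b], built algebraically: the power is expanded over
    all words [f] in the indices, and each monomial in the [X i] is replaced by its mean. Words
    leaving [J] contribute nothing because [b] vanishes there; on the others the two factors are
    independent. *)
Lemma conditional_moment X b J K N : moment_independent X ->
  [disjoint J & K] -> (forall i, poly_in X K (b i)) ->
  (forall i, i \notin J -> b i = 0) ->
  exists2 h, E ((\sum_i b i * X i) ^+ N) = E h &
    forall w, ev w h = E ((\sum_i io (ev w (b i)) * X i) ^+ N).
Proof.
move=> Xind JK bK bJ.
have expand (c : I -> AA) : (\sum_i c i * X i) ^+ N =
    \sum_(f : {ffun 'I_N -> I}) (\prod_k c (f k)) * \prod_k X (f k).
  rewrite -[in LHS](card_ord N) -prodr_const bigA_distr_bigA /=.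
  by apply: eq_bigr => f _; rewrite big_split.
exists (\sum_(f : {ffun 'I_N -> I}) io (E (\prod_k X (f k))) * \prod_k b (f k)).
  rewrite expand !raddf_sum; apply: eq_bigr => f _.
  rewrite E_io; have [/forallP fJ|/forallPn[k fk]] := boolP [forall k, f k \in J].
    rewrite mulrC; apply: moment_independentM Xind JK _ _.
      by apply: poly_in_prod => k _; apply: poly_in_gen.
    by apply: poly_in_prod.
  by rewrite (bigD1 k) //= bJ // !mul0r raddf0 mulr0.
move=> w; rewrite expand rmorph_sum raddf_sum; apply: eq_bigr => f _.
rewrite rmorphM rmorph_prod ev_io.
by rewrite -(rmorph_prod io) E_io mulrC.
Qed.

Lemma conditional_rosenthal X (p : I -> R) (K beta : R) b (J J' : {set I}) N :
  (forall i, 0 <= p i) -> 0 < K -> 1 <= beta -> (1 < N)%N -> ~~ odd N ->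
  moment_independent X -> moment_bound X p K beta ->
  [disjoint J & J'] -> (forall i, poly_in X J' (b i)) ->
  (forall i, i \notin J -> b i = 0) ->
  E ((\sum_i b i * X i) ^+ N) <= rosenthal_constant K beta ^+ N *
    (N%:R ^+ N./2 * E ((\sum_i io (p i) * b i ^+ 2) ^+ N./2) +
     (N%:R `^ beta) ^+ N * \sum_i p i * E (b i ^+ N)).
Proof.
move=> p0 K0 beta1 N1 oddN Xind Xb JJ' bJ' bJ.
have [h -> hE] := conditional_moment N Xind JJ' bJ' bJ.
set C := rosenthal_constant _ _.
rewrite [leRHS](_ : _ = E (io (C ^+ N) *
  (io (N%:R ^+ N./2) * (\sum_i io (p i) * b i ^+ 2) ^+ N./2 +
   io ((N%:R `^ beta) ^+ N) * \sum_i io (p i) * b i ^+ N))); last first.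
  rewrite E_io raddfD !E_io raddf_sum.
  by congr (_ * (_ + _ * _)); apply: eq_bigr => i _; rewrite E_io.
apply: E_le => w; rewrite hE.
apply: le_trans (rosenthal (fun i => ev w (b i)) p0 K0 beta1 N1 oddN Xind Xb) _.
have sumE m : ev w (\sum_i io (p i) * b i ^+ m) =
    weighted_moment p (fun i => ev w (b i)) m.
  by rewrite rmorph_sum; apply: eq_bigr => i _; rewrite rmorphM rmorphXn ev_io.
rewrite (rmorphM (ev w)) (rmorphD (ev w)) !(rmorphM (ev w)) !ev_io.
by rewrite (rmorphXn (ev w)) !sumE (exprMn _ N%:R).
Qed.

End Conditioning.

(** * Decoupling and the chaos *)

Section Decoupling.
Context (I : finType).

(* A uniformly random subset contains [i] and misses [j] with probability 1/4. *)
Lemma card_separating (i j : I) : i != j ->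
  4 * \sum_(f : {ffun I -> bool}) (f i && ~~ f j)%:R =
  #|{ffun I -> bool}|%:R :> R.
Proof.
move=> ij.
pose F k (b : bool) : R := if k == i then b%:R else if k == j then (~~ b)%:R else 1.
have -> : \sum_(f : {ffun I -> bool}) (f i && ~~ f j)%:R =
    \sum_(f : {ffun I -> bool}) \prod_k F k (f k).
  apply: eq_bigr => f _; rewrite (bigD1 i) // (bigD1 j) 1?eq_sym //=.
  rewrite /F eqxx [j == i]eq_sym (negbTE ij) eqxx big1 ?mulr1 ?mulnb ?natrM //.
    by rewrite -natrM mulnb.
  by move=> k /andP[/negbTE -> /negbTE ->].
rewrite -bigA_distr_bigA /= (bigD1 i) // (bigD1 j) 1?eq_sym //=.
rewrite !big_bool /F eqxx [j == i]eq_sym (negbTE ij) eqxx /= addr0 add0r !mul1r.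
rewrite (eq_bigr (fun=> 2%:R)); last first.
  by move=> k /andP[/negbTE -> /negbTE ->]; rewrite big_bool.
rewrite card_ffun card_bool natrX -prodr_const [RHS](bigD1 i) // (bigD1 j) 1?eq_sym //=.
by rewrite mulrA -natrM.
Qed.

(** By [card_separating] the off-diagonal form is 4 times the average of its separated parts over
    all subsets, so convexity bounds its moment by [4 ^+ N] times the worst of theirs. *)
Lemma decoupling (x : I -> AA) (a : I -> I -> R) N B : ~~ odd N -> (0 < N)%N ->
  (forall f : {ffun I -> bool},
    E ((\sum_(i | f i) \sum_(j | ~~ f j) io (a i j) * x i * x j) ^+ N) <= B) ->
  E ((\sum_i \sum_(j | i != j) io (a i j) * x i * x j) ^+ N) <= 4 ^+ N * B.
Proof.
move=> oddN N0 hB.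
pose y (f : {ffun I -> bool}) := \sum_(i | f i) \sum_(j | ~~ f j) io (a i j) * x i * x j.
set n := #|{ffun I -> bool}|%:R : R.
have Fpos : (0 < #|{ffun I -> bool}|)%N by apply/card_gt0P; exists [ffun=> true].
have n0 : 0 < n by rewrite ltr0n.
have avg : \sum_i \sum_(j | i != j) io (a i j) * x i * x j =
    io (4 / n) * \sum_f y f.
  have -> : \sum_f y f =
      \sum_i \sum_j io (\sum_(f : {ffun I -> bool}) (f i && ~~ f j)%:R) * (io (a i j) * x i * x j).
    rewrite /y; under eq_bigr do rewrite big_mkcond /=.
    rewrite exchange_big /=; apply: eq_bigr => i _.
    rewrite (eq_bigr (fun f : {ffun I -> bool} =>
        \sum_j io (f i && ~~ f j)%:R * (io (a i j) * x i * x j))).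
      by rewrite exchange_big /=; apply: eq_bigr => j _; rewrite rmorph_sum mulr_suml.
    move=> f _; case: (f i) => /=; last by rewrite big1 // => j _; rewrite rmorph0 mul0r.
    by rewrite big_mkcond /=; apply: eq_bigr => j _; case: (f j) => /=;
      rewrite ?rmorph0 ?mul0r ?rmorph1 ?mul1r.
  rewrite mulr_sumr; apply: eq_bigr => i _; rewrite mulr_sumr big_mkcond /=.
  apply: eq_bigr => j _; rewrite mulrA -rmorphM.
  case: (altP (i =P j)) => [<-|ij] /=.
    by rewrite big1 ?mulr0 ?rmorph0 ?mul0r // => f _; rewrite andbN.
  by rewrite [4 / n * _]mulrAC card_separating // -/n divff ?gt_eqF // rmorph1 mul1r.
rewrite avg exprMn -rmorphXn E_io.
apply: (@le_trans _ _ ((4 / n) ^+ N * (n ^+ N.-1 * (n * B)))).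
  rewrite ler_wpM2l ?exprn_ge0 ?divr_ge0 ?(ltW n0) //.
  apply: (@le_trans _ _ (E (io (n ^+ N.-1) * \sum_f y f ^+ N))).
    apply: E_le => w; rewrite (rmorphM (ev w)) ev_io (rmorphXn (ev w)).
    rewrite !(rmorph_sum (ev w)); apply: le_trans (power_mean _ Fpos oddN N0) _.
    rewrite ler_wpM2l ?exprn_ge0 ?(ltW n0) //.
    by apply: ler_sum => f _; rewrite rmorphXn.
  rewrite E_io raddf_sum ler_wpM2l ?exprn_ge0 ?(ltW n0) //.
  by rewrite /n mulr_natl -sumr_const; apply: ler_sum => f _; exact: hB.
rewrite mulrA -exprSr prednK // mulrA -exprMn divfK ?gt_eqF //.
Qed.

End Decoupling.

Lemma E_io1 c : E (io c) = c.
Proof. by rewrite -[io c]mulr1 E_io E1 mulr1. Qed.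

Lemma E_sqr_le x : E x ^+ 2 <= E (x ^+ 2).
Proof.
have : 0 <= E ((x - io (E x)) ^+ 2).
  by apply: E_pos => w; rewrite rmorphXn exprn_even_ge0.
rewrite sqrrB raddfD raddfB /= -rmorphXn E_io1 [x * _]mulrC -mulr_natl mulrCA.
rewrite -(rmorph_nat io) !E_io.
move=> h; rewrite -subr_ge0; apply: le_trans h _.
by rewrite le_eqVlt; apply/orP; left; apply/eqP; ring.
Qed.

Lemma E_exprnD_le x y N : ~~ odd N -> (0 < N)%N ->
  E ((x + y) ^+ N) <= 2 ^+ N * (E (x ^+ N) + E (y ^+ N)).
Proof.
move=> oddN N0; rewrite -raddfD -E_io; apply: E_le => w.
rewrite (rmorphM (ev w)) ev_io (rmorphD (ev w)) !(rmorphXn (ev w)) (rmorphD (ev w)).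
exact: exprnD_even_le.
Qed.

(** * Centered squares, which satisfy moment bounds with exponent [2 * beta] *)

Section CenteredSquares.
Context (I : finType).
Implicit Types (X : I -> AA) (p : I -> R) (K beta : R).

Definition centered_square X i := X i ^+ 2 - io (E (X i ^+ 2)).

(** The moment of order [2 * m] of [X i] yields [K ^+ 2] and the power of 2 with exponent
    [2 * beta]; the leading [2] pays for the binomial expansion of the centering. *)
Definition square_constant K beta := 2 * K ^+ 2 * 2 `^ (2 * beta).

Lemma moment_independent_square X : moment_independent X ->
  moment_independent (centered_square X).
Proof.
move=> Xind m; apply: (moment_independent_prod Xind) => i.
apply: poly_inX; rewrite /centered_square -rmorphN.
apply: poly_inD; last exact: poly_in_cst.
by apply: poly_inX; apply: poly_in_gen; rewrite inE.
Qed.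

Lemma moment_bound_square X p K beta : (forall i, 0 <= p i <= 1) -> 0 <= K ->
  0 <= beta -> moment_bound X p K beta ->
  moment_bound (centered_square X) p (square_constant K beta) (2 * beta).
Proof.
move=> p01 K0 beta0 Xb i; have [_ Xm] := Xb i.
have /andP[p0 p1] := p01 i.
split; first by rewrite raddfB /= E_io1 subrr.
move=> m m1; have m0 : (0 < m)%N by apply: ltn_trans m1.
pose Q := K * (2 * m)%:R `^ beta; set e := E (X i ^+ 2).
have Q0 : 0 <= Q by rewrite mulr_ge0 ?powR_ge0.
have Xle r : (0 < r <= m)%N -> `|E (X i ^+ (2 * r))| <= p i * Q ^+ (2 * r).
  move=> /andP[r0 rm]; apply: le_trans (Xm _ _) _.
    by rewrite mul2n -addnn; case: r r0 {rm} => // r _; rewrite addSn addnS.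
  rewrite ler_wpM2l //; apply: lerXn2r; rewrite ?nnegrE ?mulr_ge0 ?powR_ge0 //.
  by rewrite ler_wpM2l // ge0_ler_powR ?nnegrE // ler_nat leq_mul2l.
have e_le : `|e| <= p i * Q ^+ 2 by have := Xle 1%N; rewrite muln1; apply; rewrite m0.
have eQ : `|e| <= Q ^+ 2.
  by apply: le_trans e_le _; rewrite -[leRHS]mul1r ler_wpM2r ?exprn_ge0.
(* Exactly one factor [p i] must be kept in every binomial term. It comes from the moment of [X i]
   when one is present; in the pure power of the mean [e] it comes from one factor [e], the others
   using [p i <= 1]. *)
have pow_le (x q : R) r : 0 <= x -> x <= p i * q -> x <= q -> (0 < r)%N ->
    x ^+ r <= p i * q ^+ r.
  move=> x0 xp xq; case: r => // r _; rewrite !exprS mulrA.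
  apply: ler_pM; rewrite ?exprn_ge0 //.
  by apply: lerXn2r; rewrite ?nnegrE // (le_trans x0).
rewrite /centered_square -/e -rmorphN exprDn raddf_sum.
apply: (@le_trans _ _ (\sum_(r < m.+1) (p i * Q ^+ (2 * m)) *+ 'C(m, r))).
  apply: le_trans (ler_norm_sum _ _ _) _; apply: ler_sum => r _.
  have rm : (r <= m)%N by rewrite -ltnS.
  rewrite raddfMn normrMn ler_wMn2r //.
  rewrite -rmorphXn mulrC E_io normrM normrX normrN -exprM.
  have [rm'|rm'] := ltnP r m.
    rewrite (_ : Q ^+ (2 * m) = (Q ^+ 2) ^+ r * Q ^+ (2 * (m - r))); last first.
      by rewrite -exprM -exprD -mulnDr subnKC.
    rewrite mulrCA; apply: ler_pM; rewrite ?exprn_ge0 //.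
      by apply: lerXn2r; rewrite ?nnegrE ?exprn_ge0.
    by apply: Xle; rewrite subn_gt0 rm' leq_subr.
  have -> : r = m :> nat by apply/eqP; rewrite eqn_leq rm rm'.
  by rewrite subnn muln0 expr0 E1 normr1 mulr1 exprM pow_le.
rewrite sumrMnr (_ : (\sum_(r < m.+1) 'C(m, r))%N = (2 ^ m)%N); last first.
  by rewrite -[2%N]/(1 + 1)%N expnDn; apply: eq_bigr => r _; rewrite !exp1n !muln1.
rewrite -[leLHS]mulr_natl natrX mulrCA ler_wpM2l // exprM -exprMn.
suff -> : square_constant K beta * m%:R `^ (2 * beta) = 2 * Q ^+ 2 by [].
rewrite /Q natrM powRM // !exprMn -!powR_mulrn ?powR_ge0 // -!powRrM.
by rewrite !(mulrC beta) /square_constant powR_mulrn // !mulrA.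
Qed.

End CenteredSquares.

(** * The self-bounding estimate for the energy *)

Section Energy.
Context (I : finType) (X : I -> AA) (p : I -> R) (K beta : R) (a : I -> I -> R).
Hypothesis p01 : forall i, 0 <= p i <= 1.
Hypothesis K0 : 0 < K.
Hypothesis beta1 : 1 <= beta.
Hypothesis Xind : moment_independent X.
Hypothesis Xb : moment_bound X p K beta.

(** In these constants, [2] comes from the power of a sum of two terms, [4] from [decoupling],
    [expR (2 * beta)] from an absorbed power of the order, and the final square from the variances.
    The shape of [energy_constant] is that of [quadratic_bound]. *)
Definition diag_constant := 2 *
  (rosenthal_constant (square_constant K beta) (2 * beta) * (1 + expR (2 * beta)) +
   (K * 2 `^ beta) ^+ 2).

Definition off_diag_constant :=
  4 * (rosenthal_constant K beta * (1 + expR (2 * beta))).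

Definition energy_constant :=
  2 * (2 * diag_constant) + (2 * off_diag_constant) ^+ 2.

(** The subset [J] is a parameter because the conditional linear forms only involve the variables on
    one side of a separation. *)
Definition energy (J : {ffun I -> bool}) : AA :=
  \sum_i io (p i) * (\sum_(j | J j) io (a i j) * X j) ^+ 2.

Definition column l := \sum_i p i * a i l ^+ 2.

Let p0 i : 0 <= p i. Proof. by have /andP[] := p01 i. Qed.

Lemma rosenthal_constant_gt0 K' beta' : 0 < K' -> 0 < rosenthal_constant K' beta'.
Proof. by move=> ?; rewrite /rosenthal_constant !mulr_gt0 ?expR_gt0 ?ltr0n. Qed.

Lemma square_constant_gt0 : 0 < square_constant K beta.
Proof. by rewrite /square_constant !mulr_gt0 ?powR_gt0 ?ltr0n ?exprn_gt0. Qed.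

Lemma diag_constant_ge0 : 0 <= diag_constant.
Proof.
by rewrite /diag_constant mulr_ge0 // addr_ge0 ?exprn_even_ge0 // mulr_ge0
  ?addr_ge0 ?expR_ge0 // ltW // rosenthal_constant_gt0 // square_constant_gt0.
Qed.

Lemma off_diag_constant_ge0 : 0 <= off_diag_constant.
Proof.
by rewrite /off_diag_constant mulr_ge0 // mulr_ge0 ?addr_ge0 ?expR_ge0 // ltW //
  rosenthal_constant_gt0.
Qed.

Lemma energy_constant_ge0 : 0 <= energy_constant.
Proof.
rewrite /energy_constant addr_ge0 ?exprn_even_ge0 //.
by do 2!apply: mulr_ge0 => //; exact: diag_constant_ge0.
Qed.

Lemma column_ge0 l : 0 <= column l.
Proof. by apply: sumr_ge0 => i _; rewrite mulr_ge0 ?exprn_even_ge0. Qed.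

Lemma variance_le i : 0 <= E (X i ^+ 2) <= p i * (K * 2 `^ beta) ^+ 2.
Proof.
have [_ /(_ 2%N isT) h] := Xb i.
rewrite (le_trans (ler_norm _) h) andbT.
by apply: E_pos => w; rewrite rmorphXn exprn_even_ge0.
Qed.

Lemma centered_squares_le (b : I -> R) (V B : R) N : (1 < N)%N -> ~~ odd N ->
  0 <= V -> 0 <= B -> (forall i, N%:R `^ (2 * beta) * `|b i| <= B) ->
  N%:R * \sum_i p i * b i ^+ 2 <= V ^+ 2 ->
  E ((\sum_i io (b i) * centered_square X i) ^+ N) <=
  rosenthal_constant (square_constant K beta) (2 * beta) ^+ N *
    (V ^+ N + (N%:R `^ (2 * beta)) ^+ 2 * (\sum_i p i * b i ^+ 2) * B ^+ (N - 2)).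
Proof.
move=> N1 oddN V0 B0 bB bV.
have beta21 : 1 <= 2 * beta by have := beta1; lra.
have Xb2 := moment_bound_square p01 (ltW K0) (le_trans ler01 beta1) Xb.
apply: le_trans (rosenthal b p0 square_constant_gt0 beta21 N1 oddN
  (moment_independent_square Xind) Xb2) _.
rewrite ler_wpM2l //.
  by rewrite exprn_ge0 // ltW // rosenthal_constant_gt0 // square_constant_gt0.
have N2 : (N./2.*2 = N)%N by rewrite even_halfK.
apply: lerD.
  rewrite -[in leRHS]N2 -mul2n exprM.
  apply: lerXn2r; rewrite ?nnegrE ?exprn_ge0 // mulr_ge0 //.
  by apply: sumr_ge0 => i _; rewrite mulr_ge0 ?exprn_even_ge0.
rewrite /weighted_moment -mulrA mulr_sumr mulr_suml mulr_sumr.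
apply: ler_sum => i _.
have -> : N%:R `^ (2 * beta) ^+ N = N%:R `^ (2 * beta) ^+ 2 * N%:R `^ (2 * beta) ^+ (N - 2) :> R.
  by rewrite -exprD subnKC.
have -> : b i ^+ N = b i ^+ 2 * `|b i| ^+ (N - 2).
  rewrite -[b i ^+ 2]ger0_norm ?exprn_even_ge0 // normrX -exprD subnKC //.
  by rewrite -normrX ger0_norm // exprn_even_ge0.
rewrite [leLHS](_ : _ = N%:R `^ (2 * beta) ^+ 2 * (p i * b i ^+ 2 *
  (N%:R `^ (2 * beta) * `|b i|) ^+ (N - 2))); last by rewrite exprMn; ring.
rewrite ler_wpM2l ?exprn_ge0 ?powR_ge0 //.
apply: ler_wpM2l; first by rewrite mulr_ge0 // exprn_even_ge0.
by apply: lerXn2r; rewrite ?nnegrE ?mulr_ge0 ?powR_ge0.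
Qed.

Context (k : nat) (G S2 : R).
Hypothesis k1 : (1 < k)%N.
Hypothesis evenk : ~~ odd k.
Hypothesis G0 : 0 <= G.
Hypothesis S20 : 0 <= S2.
Hypothesis total_le : \sum_l p l * column l <= G.
Hypothesis column_le : forall l, k%:R `^ (2 * beta) * column l <= G.
Hypothesis spectral : forall c : I -> R,
  \sum_l p l * (\sum_i p i * a i l * c i) ^+ 2 <= S2 * \sum_i p i * c i ^+ 2.
Hypothesis spectral_le : k%:R * S2 <= G.

Let k0 : (0 < k)%N. Proof. exact: ltn_trans k1. Qed.

Let kR : 1 <= k%:R :> R. Proof. by rewrite ler1n. Qed.

Let halfk : (k./2.*2 = k)%N. Proof. by rewrite even_halfK. Qed.

Let k_exp : k%:R `^ (2 * beta) <= expR (2 * beta) ^+ k.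
Proof. by apply: powR_natr_le_expR => //; have := beta1; lra. Qed.

Let k_pow : k%:R <= k%:R `^ (2 * beta) :> R.
Proof. by apply: le1r_powR => //; have := beta1; lra. Qed.

(** The squares are centered and fall under Rosenthal with exponent [2 * beta]; the mean [c] that
    remains is controlled by the weighted total of the columns. *)
Lemma diag_le (J : {ffun I -> bool}) :
  E ((\sum_(j | J j) io (column j) * X j ^+ 2) ^+ k) <= (diag_constant * G) ^+ k.
Proof.
pose b j := if J j then column j else 0.
pose c := \sum_j b j * E (X j ^+ 2).
have b0 j : 0 <= b j by rewrite /b; case: ifP => // _; exact: column_ge0.
have bcol j : b j <= column j by rewrite /b; case: ifP => // _; exact: column_ge0.
have bG j : k%:R `^ (2 * beta) * b j <= G.
  by apply: le_trans (column_le j); rewrite ler_wpM2l ?powR_ge0.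
have bsum : \sum_j p j * b j <= G.
  by apply: le_trans total_le; apply: ler_sum => j _; rewrite ler_wpM2l.
have -> : \sum_(j | J j) io (column j) * X j ^+ 2 =
    \sum_j io (b j) * centered_square X j + io c.
  rewrite /c rmorph_sum -big_split big_mkcond /=; apply: eq_bigr => j _.
  rewrite /centered_square /b rmorphM; case: (J j).
    by rewrite -mulrDr subrK.
  by rewrite !rmorph0 !mul0r addr0.
set Y := \sum_j _.
(* One factor of each square is bounded by [column_le], the other summed by [total_le]. Cancelling
   one power of [k] leaves the variance condition, since [k] is at most its power with exponent
   [2 * beta]. *)
have sq_le : (k%:R `^ (2 * beta)) ^+ 2 * (\sum_i p i * b i ^+ 2) <=
    k%:R `^ (2 * beta) * G * G.
  by rewrite -[X in _ <= _ * X]expr1; apply: scaled_sum_exprn_le => //; rewrite powR_ge0.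
have sq_ge0 : 0 <= \sum_i p i * b i ^+ 2.
  by apply: sumr_ge0 => i _; rewrite mulr_ge0 // exprn_ge0.
have kb0 : 0 < k%:R `^ (2 * beta) :> R by rewrite powR_gt0 // (lt_le_trans ltr01).
set C := rosenthal_constant (square_constant K beta) (2 * beta).
have C0 : 0 < C by rewrite rosenthal_constant_gt0 // square_constant_gt0.
have YE : E (Y ^+ k) <= (C * (1 + expR (2 * beta)) * G) ^+ k.
  apply: le_trans (centered_squares_le (V := G) (B := G) k1 evenk G0 G0 _ _) _.
  - by move=> j; rewrite ger0_norm.
  - apply: (@le_trans _ _ (k%:R `^ (2 * beta) * \sum_i p i * b i ^+ 2)).
      by rewrite ler_wpM2r.
    by move: sq_le; rewrite expr2 -!mulrA ler_pM2l.
  rewrite -[C * _ * G]mulrA [leRHS]exprMn ler_wpM2l ?exprn_ge0 ?(ltW C0) //.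
  rewrite exprMn; apply: (@le_trans _ _ ((1 + expR (2 * beta) ^+ k) * G ^+ k)).
    rewrite [leRHS]mulrDl mul1r lerD2l.
    apply: (@le_trans _ _ (k%:R `^ (2 * beta) * G * G * G ^+ (k - 2))).
      by rewrite ler_wpM2r ?exprn_ge0.
    rewrite -!mulrA -!exprS -subSn // subSS -[(k - 1).+1]subSn ?subSS ?subn0 //.
    by rewrite ler_wpM2r ?exprn_ge0.
  rewrite ler_wpM2r ?exprn_ge0 // -[X in X + _](expr1n _ k).
  by rewrite exprnD_ge ?expR_ge0.
have c0 : 0 <= c.
  by apply: sumr_ge0 => j _; rewrite mulr_ge0 //; have /andP[] := variance_le j.
have cG : c <= (K * 2 `^ beta) ^+ 2 * G.
  apply: (@le_trans _ _ ((K * 2 `^ beta) ^+ 2 * \sum_j p j * b j)); last first.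
    by rewrite ler_wpM2l ?exprn_ge0 ?mulr_ge0 ?powR_ge0 ?(ltW K0).
  rewrite mulr_sumr; apply: ler_sum => j _.
  have /andP[_ h] := variance_le j.
  rewrite [leRHS](_ : _ = b j * (p j * (K * 2 `^ beta) ^+ 2)); last by ring.
  by rewrite ler_wpM2l.
apply: (@le_trans _ _ (2 ^+ k * (E (Y ^+ k) + c ^+ k))).
  by rewrite -[c ^+ k]E_io1 rmorphXn E_exprnD_le.
have D0 : 0 <= C * (1 + expR (2 * beta)) * G.
  by apply: mulr_ge0 => //; apply: mulr_ge0; [exact: ltW|rewrite addr_ge0 ?expR_ge0].
apply: (@le_trans _ _ (2 ^+ k * ((C * (1 + expR (2 * beta)) * G) ^+ k +
   ((K * 2 `^ beta) ^+ 2 * G) ^+ k))).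
  rewrite ler_wpM2l ?exprn_ge0 // lerD //.
  by apply: lerXn2r; rewrite ?nnegrE // (le_trans c0).
rewrite /diag_constant -/C -[2 * _ * G]mulrA [leRHS]exprMn ler_wpM2l ?exprn_ge0 //.
rewrite [(_ + _ ^+ 2) * G]mulrDl.
by rewrite exprnD_ge // mulr_ge0 // exprn_ge0 // mulr_ge0 ?powR_ge0 ?(ltW K0).
Qed.

Definition gram l j := \sum_i p i * a i l * a i j.

(** Order [k / 2] is what Rosenthal's inequality at order [k] produces; the square root gained here
    makes the recursion solvable. *)
Lemma energy_half_le Z (J : {ffun I -> bool}) :
  E (energy J ^+ k) <= Z -> E (energy J ^+ k./2) <= Num.sqrt Z.
Proof.
move=> JZ; apply: le_trans (ler_norm _) _.
rewrite -sqrtr_sqr; apply: ler_wsqrtr; apply: le_trans (E_sqr_le _) _.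
by rewrite -exprM muln2 halfk.
Qed.

(* The decoupled form is linear in [X l] with coefficients
   [sum_i p i * a i l * c i], where [c] are the linear forms squared in [energy J']:
   their total weight is at most [S2 * energy J'] and each square at most
   [column l * energy J']. *)
Lemma off_diag_le Z (J : {ffun I -> bool}) :
  (forall J', E (energy J' ^+ k) <= Z) ->
  E ((\sum_i \sum_(j | i != j) io (gram i j) * (if J i then X i else 0) *
       (if J j then X j else 0)) ^+ k) <=
  off_diag_constant ^+ k * (G ^+ k./2 * Num.sqrt Z).
Proof.
move=> hZ; rewrite exprMn -mulrA; apply: decoupling => // f.
(* The inner forms live on the part of [J] missed by [f]: the bound [Z] therefore has to hold for
   all subsets. *)
pose J' : {ffun I -> bool} := [ffun j => J j && ~~ f j].
pose b l := if f l && J l then \sum_(j | J' j) io (gram l j) * X j else 0.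
have -> : \sum_(i | f i) \sum_(j | ~~ f j)
    io (gram i j) * (if J i then X i else 0) * (if J j then X j else 0) =
    \sum_l b l * X l.
  rewrite big_mkcond /=; apply: eq_bigr => l _.
  rewrite /b; case: (f l); last by rewrite mul0r.
  case: (J l); last first.
    by rewrite mul0r big1 // => j _; rewrite mulr0 mul0r.
  rewrite mulr_suml big_mkcond [RHS]big_mkcond /=; apply: eq_bigr => j _.
  by rewrite ffunE; case: (J j); case: (f j) => //=; rewrite ?mulr0 // mulrAC.
have C0 := rosenthal_constant_gt0 beta K0.
set W := \sum_i io (p i) * (\sum_(j | J' j) io (a i j) * X j) ^+ 2.
have evW w : ev w W = \sum_i p i * (\sum_(j | J' j) a i j * ev w (X j)) ^+ 2.
  rewrite rmorph_sum; apply: eq_bigr => i _; rewrite rmorphM ev_io rmorphXn.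
  by rewrite rmorph_sum; under eq_bigr do rewrite rmorphM ev_io.
have evb w l : ev w (b l) = if f l && J l then
    \sum_i p i * a i l * (\sum_(j | J' j) a i j * ev w (X j)) else 0.
  rewrite /b; case: ifP => _; last by rewrite rmorph0.
  rewrite rmorph_sum; under eq_bigr do rewrite rmorphM ev_io mulr_suml.
  rewrite exchange_big /=; apply: eq_bigr => i _; rewrite mulr_sumr.
  by apply: eq_bigr => j _; rewrite mulrA.
apply: le_trans (conditional_rosenthal (J := [set l | f l && J l])
  (J' := [set j | J' j]) (b := b) p0 K0 beta1 k1 evenk Xind Xb _ _ _) _.
- rewrite -setI_eq0; apply/eqP/setP => l; rewrite !inE ffunE.
  by case: (f l); case: (J l).
- move=> l; rewrite /b; case: ifP => _.
    apply: poly_in_sum => j jJ; apply: poly_inM; first exact: poly_in_cst.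
    by apply: poly_in_gen; rewrite inE.
  by rewrite -(rmorph0 io); apply: poly_in_cst.
- by move=> l; rewrite inE /b => /negbTE ->.
rewrite [(_ * (1 + _)) ^+ k]exprMn -[leRHS]mulrA ler_wpM2l ?exprn_ge0 ?(ltW C0) //.
have sqrt0 := sqrtr_ge0 Z.
have W0 w : 0 <= ev w W.
  by rewrite evW sumr_ge0 // => i _; rewrite mulr_ge0 ?exprn_even_ge0.
have Whalf := energy_half_le (hZ J').
have h1 : k%:R ^+ k./2 * E ((\sum_i io (p i) * b i ^+ 2) ^+ k./2) <=
    G ^+ k./2 * Num.sqrt Z.
  apply: (@le_trans _ _ (k%:R ^+ k./2 * E (io (S2 ^+ k./2) * W ^+ k./2))).
    rewrite ler_wpM2l ?exprn_ge0 //; apply: E_le => w.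
    rewrite rmorphM ev_io !(rmorphXn (ev w)) -exprMn.
    have -> : ev w (\sum_i io (p i) * b i ^+ 2) = \sum_l p l * (ev w (b l)) ^+ 2.
      by rewrite rmorph_sum; apply: eq_bigr => l _; rewrite rmorphM ev_io rmorphXn.
    have bb0 : 0 <= \sum_l p l * (ev w (b l)) ^+ 2.
      by apply: sumr_ge0 => l _; rewrite mulr_ge0 ?exprn_even_ge0.
    apply: lerXn2r; rewrite ?nnegrE ?mulr_ge0 // evW.
    apply: le_trans (spectral _); apply: ler_sum => l _; rewrite ler_wpM2l // evb.
    by case: ifP => // _; rewrite expr0n /= exprn_even_ge0.
  rewrite E_io mulrA -exprMn; apply: ler_pM => //.
  - by rewrite exprn_ge0 // mulr_ge0.
  - by apply: E_pos => w; rewrite rmorphXn exprn_ge0.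
  - by apply: lerXn2r; rewrite ?nnegrE ?mulr_ge0.
have h2 : (k%:R `^ beta) ^+ k * (\sum_i p i * E (b i ^+ k)) <=
    expR (2 * beta) ^+ k * (G ^+ k./2 * Num.sqrt Z).
  apply: (@le_trans _ _ ((k%:R `^ beta) ^+ k *
      (\sum_l p l * column l ^+ k./2) * Num.sqrt Z)).
    rewrite -mulrA ler_wpM2l ?exprn_ge0 ?powR_ge0 // mulr_suml.
    apply: ler_sum => l _; rewrite -mulrA ler_wpM2l //.
    apply: (@le_trans _ _ (E (io (column l ^+ k./2) * W ^+ k./2))).
      apply: E_le => w; rewrite rmorphM ev_io !(rmorphXn (ev w)) -exprMn.
      rewrite -{1}halfk -mul2n exprM.
      apply: lerXn2r; rewrite ?nnegrE ?exprn_even_ge0 ?mulr_ge0 ?column_ge0 //.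
      rewrite evb; case: ifP => _; first by rewrite evW weighted_CS.
      by rewrite expr0n /= mulr_ge0 ?column_ge0.
    by rewrite E_io ler_wpM2l ?exprn_ge0 ?column_ge0.
  rewrite mulrA ler_wpM2r //.
  have -> : (k%:R `^ beta) ^+ k = (k%:R `^ (2 * beta)) ^+ k./2 :> R.
    by rewrite -powR_sqr -exprM mul2n halfk.
  (* One of the [k / 2] factors [column l] is summed by [total_le], the others are bounded by
     [column_le]; the single power of [k] left over is absorbed by [k_exp]. *)
  case: (k./2) (half_gt0 k) => [|m _]; first by rewrite k1.
  apply: le_trans (scaled_sum_exprn_le m p0 column_ge0 (powR_ge0 _ _) G0
    column_le total_le) _.
  by rewrite -mulrA -exprS ler_wpM2r ?exprn_ge0.
apply: le_trans (lerD h1 h2) _.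
rewrite -[X in X + _]mul1r -mulrDl ler_wpM2r ?mulr_ge0 ?exprn_ge0 //.
by rewrite -[X in X + _](expr1n _ k) exprnD_ge ?expR_ge0.
Qed.

Lemma energy_le (J : {ffun I -> bool}) :
  E (energy J ^+ k) <= (energy_constant * G) ^+ k.
Proof.
(* The finite maximum over all subsets is the unknown: it bounds the moments on both sides of
   [step], with only its square root on the right. *)
pose Z := \big[Num.max/0]_(J : {ffun I -> bool}) E (energy J ^+ k).
have hZ J' : E (energy J' ^+ k) <= Z by exact: le_bigmax.
have Z0 : 0 <= Z by exact: bigmax_ge_id.
apply: le_trans (hZ J) _.
have DO := diag_constant_ge0.
have OO := off_diag_constant_ge0.
have DDk : 0 <= (2 * diag_constant) ^+ k by apply: exprn_ge0; apply: mulr_ge0.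
have OOk : 0 <= (2 * off_diag_constant) ^+ k by apply: exprn_ge0; apply: mulr_ge0.
have step : Z <= (2 * diag_constant) ^+ k * (G ^+ k./2) ^+ 2 +
    (2 * off_diag_constant) ^+ k * G ^+ k./2 * Num.sqrt Z.
  have RHS0 : 0 <= (2 * diag_constant) ^+ k * (G ^+ k./2) ^+ 2 +
    (2 * off_diag_constant) ^+ k * G ^+ k./2 * Num.sqrt Z.
    by apply: addr_ge0; apply: mulr_ge0; rewrite ?sqrtr_ge0 ?exprn_even_ge0 //;
      apply: mulr_ge0; rewrite // exprn_ge0.
  apply: bigmax_le => // J' _.
  have split : energy J' = \sum_(j | J' j) io (column j) * X j ^+ 2 +
     \sum_i \sum_(j | i != j) io (gram i j) * (if J' i then X i else 0) *
       (if J' j then X j else 0).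
    have -> : energy J' = \sum_l \sum_j io (gram l j) *
        (if J' l then X l else 0) * (if J' j then X j else 0).
      rewrite /energy.
      have sq i : (\sum_(j | J' j) io (a i j) * X j) ^+ 2 = \sum_l \sum_j
          io (a i l * a i j) * (if J' l then X l else 0) * (if J' j then X j else 0).
        rewrite expr2 mulr_suml big_mkcond; apply: eq_bigr => l _.
        case: ifP => _; last by rewrite big1 // => j _; rewrite mulr0 mul0r.
        rewrite mulr_sumr big_mkcond; apply: eq_bigr => j _.
        by case: ifP => _; rewrite ?mulr0 // rmorphM; ring.
      under eq_bigr do rewrite sq mulr_sumr.
      rewrite exchange_big; apply: eq_bigr => l _ /=.
      under eq_bigr do rewrite mulr_sumr.
      rewrite exchange_big; apply: eq_bigr => j _ /=.
      rewrite /gram rmorph_sum !mulr_suml; apply: eq_bigr => i _.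
      by rewrite -[p i * _ * _]mulrA (rmorphM io (p i)) !mulrA.
    rewrite [X in X + _]big_mkcond -big_split /=; apply: eq_bigr => l _.
    rewrite (bigD1 l) //=; congr (_ + _).
      case: ifP => _; last by rewrite !mulr0.
      rewrite -mulrA -expr2; congr (io _ * _); apply: eq_bigr => i _.
      by rewrite -mulrA.
    by apply: eq_bigl => j; rewrite eq_sym.
  rewrite {}split; apply: le_trans (E_exprnD_le _ _ evenk k0) _.
  rewrite mulrDr; apply: lerD.
    rewrite -exprM muln2 halfk -exprMn -mulrA [leRHS]exprMn ler_wpM2l ?exprn_ge0 //.
    exact: diag_le.
  rewrite -mulrA [(2 * off_diag_constant) ^+ k]exprMn -mulrA ler_wpM2l ?exprn_ge0 //.
  exact: off_diag_le.
(* Solving the inequality for the square root of [Z] gives [2 * A + B ^+ 2] with [A] and [B] powers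
   of order [k]; the isolated [2] is at most [2 ^+ k]. *)
have := @quadratic_bound _ ((2 * diag_constant) ^+ k) ((2 * off_diag_constant) ^+ k)
  (G ^+ k./2) (Num.sqrt Z) (exprn_ge0 _ G0) (sqrtr_ge0 _).
rewrite sqr_sqrtr // => /(_ step) /le_trans; apply.
rewrite -[(G ^+ _) ^+ 2]exprM muln2 halfk [leRHS]exprMn ler_wpM2r ?exprn_ge0 //.
rewrite /energy_constant.
have D2 : 0 <= 2 * (2 * diag_constant) by do 2!apply: mulr_ge0 => //.
apply: le_trans (exprnD_ge D2 _ k0); rewrite ?exprn_even_ge0 //.
rewrite exprAC lerD2r [leRHS]exprMn ler_wpM2r //.
by rewrite -[leLHS]expr1 ler_weXn2l // ler1n.
Qed.

End Energy.

(** * Moments of the centered quadratic chaos *)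

Section Chaos.
Context (I : finType) (X : I -> AA) (p : I -> R) (K beta : R) (a : I -> I -> R).
Hypothesis p01 : forall i, 0 <= p i <= 1.
Hypothesis K0 : 0 < K.
Hypothesis beta1 : 1 <= beta.
Hypothesis Xind : moment_independent X.
Hypothesis Xb : moment_bound X p K beta.
Hypothesis a_sym : forall i j, a i j = a j i.
Context (N : nat) (tau S2 : R).
Hypothesis N4 : (4 %| N)%N.
Hypothesis N0 : (0 < N)%N.
Hypothesis tau0 : 0 <= tau.
Hypothesis S20 : 0 <= S2.
Hypothesis spectral : forall c : I -> R,
  \sum_l p l * (\sum_i p i * a i l * c i) ^+ 2 <= S2 * \sum_i p i * c i ^+ 2.
Hypothesis diag_tau : N%:R * \sum_i p i * a i i ^+ 2 <= tau ^+ 2.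
Hypothesis total_tau : N%:R * \sum_l p l * column p a l <= tau ^+ 2.
Hypothesis spectral_tau : N%:R ^+ 2 * S2 <= tau ^+ 2.
Hypothesis column_tau : forall l,
  N%:R `^ (2 * beta) * N%:R * column p a l <= tau ^+ 2.
Hypothesis entry_tau : forall i j, N%:R `^ (2 * beta) * `|a i j| <= tau.

Definition chaos_diag_constant :=
  rosenthal_constant (square_constant K beta) (2 * beta) * (1 + expR (4 * beta)).

(** The energy enters at order [N / 2], so the square root of [energy_constant] would suffice;
    [1 + energy_constant] dominates it. The inner [rosenthal_constant] comes from the second use of
    Rosenthal, on the rows. *)
Definition chaos_off_constant := 4 * (rosenthal_constant K beta *
  ((1 + energy_constant K beta) +
   rosenthal_constant K beta * (expR (2 * beta) + expR (4 * beta)))).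

Definition chaos_constant := 2 * (chaos_diag_constant + chaos_off_constant).

Let p0 i : 0 <= p i. Proof. by have /andP[] := p01 i. Qed.

Let evenN : ~~ odd N. Proof. by rewrite -dvdn2; apply: dvdn_trans N4. Qed.

Let halfN : (N./2.*2 = N)%N. Proof. by rewrite even_halfK. Qed.

Let N_gt1 : (1 < N)%N. Proof. by apply: leq_trans (dvdn_leq N0 N4). Qed.

Let half_gt1 : (1 < N./2)%N.
Proof. by have /half_leq := dvdn_leq N0 N4. Qed.

Let even_half : ~~ odd N./2.
Proof.
case/dvdnP: N4 => m ->; rewrite (_ : m * 4 = (m * 2).*2)%N.
  by rewrite doubleK oddM andbF.
by rewrite -muln2 -mulnA.
Qed.

Let NR : 1 <= N%:R :> R. Proof. by rewrite ler1n. Qed.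

Let NR0 : 0 < N%:R :> R. Proof. exact: lt_le_trans NR. Qed.

Let b0 : 0 <= beta. Proof. exact: le_trans beta1. Qed.

Let tauN : (tau ^+ 2) ^+ N./2 = tau ^+ N.
Proof. by rewrite -exprM mul2n halfN. Qed.

Let total_le : \sum_l p l * column p a l <= tau ^+ 2 / N%:R.
Proof. by rewrite ler_pdivlMr // mulrC. Qed.

Let total_le1 : \sum_l p l * column p a l <= tau ^+ 2.
Proof.
apply: le_trans total_tau; rewrite -[leLHS]mul1r ler_wpM2r //.
by apply: sumr_ge0 => l _; rewrite mulr_ge0 ?column_ge0.
Qed.

(** [energy_le] at order [N / 2] with [G = tau ^+ 2 / N]; the prefactor cancels the denominators of
    [G]. *)
Lemma chaos_energy_le (J : {ffun I -> bool}) :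
  N%:R ^+ N./2 * E (energy X p a J ^+ N./2) <=
  ((1 + energy_constant K beta) * tau) ^+ N.
Proof.
have G0 : 0 <= tau ^+ 2 / N%:R by rewrite divr_ge0 ?exprn_ge0.
have halfle : (N./2)%:R <= N%:R :> R by rewrite ler_nat -[leqRHS]halfN -addnn leq_addr.
have ec0 := energy_constant_ge0 beta K0.
apply: (@le_trans _ _ (N%:R ^+ N./2 * (energy_constant K beta * (tau ^+ 2 / N%:R)) ^+ N./2)).
  rewrite ler_wpM2l ?exprn_ge0 //.
  apply: (@energy_le _ _ _ _ _ _ p01 K0 beta1 Xind Xb N./2 _ S2) => //.
  - move=> l; rewrite ler_pdivlMr // mulrC mulrA; apply: le_trans (column_tau l).
    rewrite ler_wpM2r ?column_ge0 // mulrC ler_wpM2r //.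
    by rewrite ge0_ler_powR ?nnegrE ?mulr_ge0.
  - rewrite ler_pdivlMr // mulrC; apply: le_trans spectral_tau.
    by rewrite expr2 -mulrA ler_wpM2l // ler_wpM2r.
rewrite -exprMn mulrCA [N%:R * _]mulrC divfK ?gt_eqF //.
have -> : ((1 + energy_constant K beta) * tau) ^+ N =
    (((1 + energy_constant K beta) * tau) ^+ 2) ^+ N./2.
  by rewrite -exprM mul2n halfN.
apply: lerXn2r; rewrite ?nnegrE ?exprn_even_ge0 ?mulr_ge0 ?exprn_ge0 //.
by rewrite exprMn ler_wpM2r ?exprn_ge0 //; nra.
Qed.

Lemma chaos_row_le (c : I -> R) i : (forall j, `|c j| <= `|a i j|) ->
  E ((\sum_j io (c j) * X j) ^+ N) <= rosenthal_constant K beta ^+ N *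
    ((N%:R * column p a i) ^+ N./2 +
     (N%:R `^ beta) ^+ N * \sum_j p j * (a i j ^+ 2) ^+ N./2).
Proof.
move=> ca; have C0 := rosenthal_constant_gt0 beta K0.
have c2 j : c j ^+ 2 <= a i j ^+ 2.
  rewrite -[leLHS]ger0_norm ?exprn_even_ge0 // -[leRHS]ger0_norm ?exprn_even_ge0 //.
  by rewrite !normrX lerXn2r ?nnegrE.
apply: le_trans (rosenthal c p0 K0 beta1 N_gt1 evenN Xind Xb) _.
rewrite ler_wpM2l ?exprn_ge0 ?(ltW C0) //; apply: lerD.
  apply: lerXn2r; rewrite ?nnegrE ?mulr_ge0 ?column_ge0 //.
    by apply: sumr_ge0 => j _; rewrite mulr_ge0 ?exprn_even_ge0.
  rewrite ler_wpM2l //; apply: ler_sum => j _.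
  by rewrite ler_wpM2l // a_sym c2.
rewrite ler_wpM2l ?exprn_ge0 ?powR_ge0 //; apply: ler_sum => j _.
rewrite ler_wpM2l // -[in leLHS]halfN -mul2n exprM.
by apply: lerXn2r; rewrite ?nnegrE ?exprn_even_ge0.
Qed.

Let powN : (N%:R `^ beta) ^+ N = (N%:R `^ (2 * beta)) ^+ N./2 :> R.
Proof. by rewrite -powR_sqr -exprM mul2n halfN. Qed.

Let Nexp s : 0 <= s -> N%:R `^ (s * beta) <= expR (s * beta) ^+ N.
Proof. by move=> s0; rewrite powR_natr_le_expR // mulr_ge0. Qed.

(** The large-deviation part of the outer Rosenthal bound, after the inner one has been applied to
    each row. [column_tau] handles the Gaussian part of a row and [entry_tau] its largest entries.
    One weighted factor is summed each time, which leaves powers of [N] with exponents [2 * beta]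
    and [4 * beta]. *)
Lemma chaos_rows_le : (N%:R `^ beta) ^+ N * (\sum_i p i *
    ((N%:R * column p a i) ^+ N./2 +
     (N%:R `^ beta) ^+ N * \sum_j p j * (a i j ^+ 2) ^+ N./2)) <=
  ((expR (2 * beta) + expR (4 * beta)) * tau) ^+ N.
Proof.
have half0 : (0 < N./2)%N by apply: ltn_trans half_gt1.
have tau2 : 0 <= tau ^+ 2 by rewrite exprn_ge0.
rewrite [leRHS]exprMn; apply: (@le_trans _ _
    ((expR (2 * beta) ^+ N + expR (4 * beta) ^+ N) * tau ^+ N)); last first.
  by rewrite ler_wpM2r ?exprn_ge0 // exprnD_ge ?expR_ge0.
under eq_bigr do rewrite mulrDr.
rewrite big_split /= mulrDr [leRHS]mulrDl; apply: lerD.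
  rewrite powN (eq_bigr (fun i => N%:R ^+ N./2 * (p i * column p a i ^+ N./2))); last first.
    by move=> i _; rewrite exprMn mulrCA.
  rewrite -mulr_sumr mulrA -exprMn.
  rewrite -tauN -(prednK half0).
  apply: le_trans (scaled_sum_exprn_le (N./2).-1 p0 (column_ge0 a p01)
     (mulr_ge0 (powR_ge0 _ _) (ltW NR0)) tau2 column_tau total_le) _.
  rewrite [(tau ^+ 2) ^+ _.+1]exprS [leRHS]mulrA ler_wpM2r ?exprn_ge0 //.
  rewrite -mulrA [N%:R * _]mulrC divfK ?gt_eqF // ler_wpM2r //.
  exact: Nexp.
rewrite powN mulr_sumr.
apply: (@le_trans _ _ (\sum_i p i * (N%:R `^ (2 * beta) ^+ 2 * column p a i *
    (tau ^+ 2) ^+ (N./2).-1))).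
  apply: ler_sum => i _; rewrite mulrCA ler_wpM2l // mulrA -exprMn -expr2.
  rewrite -[in leLHS](prednK half0); apply: scaled_sum_exprn_le => //.
  - by move=> j; rewrite exprn_even_ge0.
  - move=> j; rewrite -exprMn -[leLHS]ger0_norm ?exprn_even_ge0 // normrX.
    apply: lerXn2r; rewrite ?nnegrE // normrM (ger0_norm (powR_ge0 _ _)).
    exact: entry_tau.
  - by apply: ler_sum => j _; rewrite a_sym.
rewrite (eq_bigr (fun i => (p i * column p a i) * (N%:R `^ (2 * beta) ^+ 2 *
    (tau ^+ 2) ^+ (N./2).-1))) => [|i _]; last by ring.
rewrite -mulr_suml -tauN -[in leRHS](prednK half0).
rewrite [(tau ^+ 2) ^+ _.+1]exprS [leRHS]mulrA.
rewrite mulrA ler_wpM2r ?exprn_ge0 // mulrC; apply: ler_pM => //.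
- by apply: sumr_ge0 => i _; rewrite mulr_ge0 ?column_ge0.
- rewrite powR_sqr mulrA (_ : 2 * 2 = 4); last by ring.
  exact: Nexp.
Qed.

Lemma chaos_off_le :
  E ((\sum_i \sum_(j | i != j) io (a i j) * X i * X j) ^+ N) <=
  (chaos_off_constant * tau) ^+ N.
Proof.
have C0 := rosenthal_constant_gt0 beta K0.
rewrite -[_ * tau]mulrA exprMn; apply: decoupling => // f.
pose J' : {ffun I -> bool} := [ffun j => ~~ f j].
pose b i := if f i then \sum_(j | J' j) io (a i j) * X j else 0.
have -> : \sum_(i | f i) \sum_(j | ~~ f j) io (a i j) * X i * X j =
    \sum_i b i * X i.
  rewrite big_mkcond /=; apply: eq_bigr => i _.
  rewrite /b; case: (f i); last by rewrite mul0r.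
  rewrite mulr_suml; apply: eq_big => j; first by rewrite ffunE.
  by rewrite mulrAC.
apply: le_trans (conditional_rosenthal (J := [set l | f l])
  (J' := [set j | J' j]) (b := b) p0 K0 beta1 N_gt1 evenN Xind Xb _ _ _) _.
- rewrite -setI_eq0; apply/eqP/setP => l; rewrite !inE ffunE.
  by case: (f l).
- move=> l; rewrite /b; case: ifP => _.
    apply: poly_in_sum => j jJ; apply: poly_inM; first exact: poly_in_cst.
    by apply: poly_in_gen; rewrite inE.
  by rewrite -(rmorph0 io); apply: poly_in_cst.
- by move=> l; rewrite inE /b => /negbTE ->.
rewrite -[_ * tau]mulrA [leRHS]exprMn ler_wpM2l ?exprn_ge0 ?(ltW C0) //.
have energy_part : N%:R ^+ N./2 * E ((\sum_i io (p i) * b i ^+ 2) ^+ N./2) <=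
    ((1 + energy_constant K beta) * tau) ^+ N.
  apply: le_trans (chaos_energy_le J').
  rewrite ler_wpM2l ?exprn_ge0 //; apply: E_le => w; rewrite !(rmorphXn (ev w)).
  have evp (x : I -> AA) : ev w (\sum_i io (p i) * x i ^+ 2) =
      \sum_i p i * (ev w (x i)) ^+ 2.
    by rewrite rmorph_sum; apply: eq_bigr => i _; rewrite rmorphM ev_io rmorphXn.
  rewrite !evp; apply: lerXn2r; rewrite ?nnegrE.
  - by apply: sumr_ge0 => i _; rewrite mulr_ge0 ?exprn_even_ge0.
  - by apply: sumr_ge0 => i _; rewrite mulr_ge0 ?exprn_even_ge0.
  apply: ler_sum => i _; rewrite ler_wpM2l // /b; case: (f i) => //.
  by rewrite rmorph0 expr0n /= exprn_even_ge0.
have rows_part : (N%:R `^ beta) ^+ N * (\sum_i p i * E (b i ^+ N)) <=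
    (rosenthal_constant K beta * ((expR (2 * beta) + expR (4 * beta)) * tau)) ^+ N.
  rewrite exprMn; apply: le_trans (ler_wpM2l _ chaos_rows_le); last first.
    by rewrite exprn_ge0 ?(ltW C0).
  rewrite mulrCA ler_wpM2l ?exprn_ge0 ?powR_ge0 // mulr_sumr.
  apply: ler_sum => i _; rewrite mulrCA ler_wpM2l //.
  have -> : b i = \sum_j io (if f i && J' j then a i j else 0) * X j.
    rewrite /b; case: (f i) => /=; last by rewrite big1 // => j _; rewrite rmorph0 mul0r.
    rewrite big_mkcond /=; apply: eq_bigr => j _.
    by case: (J' j); rewrite ?rmorph0 ?mul0r.
  by apply: chaos_row_le => j; case: ifP => // _; rewrite normr0.
apply: le_trans (lerD energy_part rows_part) _.
have ec0 := energy_constant_ge0 beta K0.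
rewrite [_ * tau in leRHS]mulrDl -[_ * _ * tau in leRHS]mulrA.
apply: exprnD_ge => //; first by apply: mulr_ge0 => //; rewrite addr_ge0.
apply: mulr_ge0; first exact: ltW.
by apply: mulr_ge0 => //; rewrite addr_ge0 ?expR_ge0.
Qed.

Lemma chaos_diag_le :
  E ((\sum_i io (a i i) * centered_square X i) ^+ N) <=
  (chaos_diag_constant * tau) ^+ N.
Proof.
have C0 := rosenthal_constant_gt0 (2 * beta) (square_constant_gt0 beta K0).
apply: le_trans (centered_squares_le p01 K0 beta1 Xind Xb (V := tau) (B := tau)
  N_gt1 evenN tau0 tau0 (fun i => entry_tau i i) diag_tau) _.
rewrite -[_ * tau]mulrA [leRHS]exprMn ler_wpM2l ?exprn_ge0 ?(ltW C0) //.
rewrite [leRHS]exprMn; apply: (@le_trans _ _ ((1 + expR (4 * beta) ^+ N) * tau ^+ N)).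
  rewrite [leRHS]mulrDl mul1r lerD2l -mulrA; apply: ler_pM.
  - by rewrite exprn_ge0 ?powR_ge0.
  - by rewrite mulr_ge0 ?exprn_ge0 // sumr_ge0 // => i _; rewrite mulr_ge0 ?exprn_even_ge0.
  - by rewrite powR_sqr mulrA (_ : 2 * 2 = 4) ?Nexp //; ring.
  have -> : tau ^+ N = tau ^+ 2 * tau ^+ (N - 2) by rewrite -exprD subnKC.
  rewrite ler_wpM2r ?exprn_ge0 //; apply: le_trans diag_tau.
  rewrite -[leLHS]mul1r ler_wpM2r // sumr_ge0 // => i _.
  by rewrite mulr_ge0 ?exprn_even_ge0.
by rewrite ler_wpM2r ?exprn_ge0 // -[X in X + _](expr1n _ N) exprnD_ge ?expR_ge0.
Qed.

Lemma chaos_diag_constant_ge0 : 0 <= chaos_diag_constant.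
Proof.
have C0' := rosenthal_constant_gt0 (2 * beta) (square_constant_gt0 beta K0).
by rewrite /chaos_diag_constant mulr_ge0 ?(ltW C0') // addr_ge0 ?expR_ge0.
Qed.

Lemma chaos_off_constant_ge0 : 0 <= chaos_off_constant.
Proof.
have C0 := rosenthal_constant_gt0 beta K0.
have ec0 := energy_constant_ge0 beta K0.
rewrite /chaos_off_constant; apply: mulr_ge0 => //; apply: mulr_ge0; first exact: ltW.
apply: addr_ge0; first by rewrite addr_ge0.
by apply: mulr_ge0; [exact: ltW | rewrite addr_ge0 ?expR_ge0].
Qed.

Lemma chaos_constant_ge0 : 0 <= chaos_constant.
Proof.
apply: mulr_ge0 => //; apply: addr_ge0.
  exact: chaos_diag_constant_ge0.
exact: chaos_off_constant_ge0.
Qed.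

Lemma chaos_moment_le :
  E ((\sum_i \sum_j io (a i j) * X i * X j -
      io (\sum_i a i i * E (X i ^+ 2))) ^+ N) <= (chaos_constant * tau) ^+ N.
Proof.
have -> : \sum_i \sum_j io (a i j) * X i * X j -
      io (\sum_i a i i * E (X i ^+ 2)) =
    \sum_i io (a i i) * centered_square X i +
    \sum_i \sum_(j | i != j) io (a i j) * X i * X j.
  rewrite rmorph_sum -sumrB -big_split /=; apply: eq_bigr => i _.
  rewrite (bigD1 i) //= rmorphM /centered_square mulrBr addrAC -mulrA -expr2.
  by congr (_ + _); apply: eq_bigl => j; rewrite eq_sym.
apply: le_trans (E_exprnD_le _ _ evenN N0) _.
rewrite /chaos_constant -[_ * tau]mulrA [leRHS]exprMn ler_wpM2l ?exprn_ge0 //.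
apply: le_trans (lerD chaos_diag_le chaos_off_le) _.
rewrite [(_ + _) * tau]mulrDl; apply: exprnD_ge => //; apply: mulr_ge0 => //.
  exact: chaos_diag_constant_ge0.
exact: chaos_off_constant_ge0.
Qed.

End Chaos.

End Expectation.

Local Open Scope classical_set_scope.

(** * Random variables with all moments *)

Section FiniteMoments.
Context d (T : measurableType d) (R : realType) (P : probability T R).
Implicit Types f g : T -> R.

Definition finite_moments : {pred T -> R} := fun f =>
  `[< measurable_fun [set: T] f /\
      forall m, P.-integrable [set: T] (fun w => (f w ^+ m)%:E) >].

Lemma dominated_integrable f g : measurable_fun [set: T] f ->
  (forall w, `|f w| <= g w) -> P.-integrable [set: T] (EFin \o g) ->
  P.-integrable [set: T] (EFin \o f).
Proof.
move=> mf fg; apply: le_integrable => //; first exact/measurable_EFinP.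
move=> w _ /=; rewrite lee_fin; apply: le_trans (fg w) _; exact: ler_norm.
Qed.

Lemma integrable_EFin_cst (c : R) : P.-integrable [set: T] (EFin \o cst c).
Proof. exact: finite_measure_integrable_cst. Qed.

Lemma integrable_EFinD f g : P.-integrable [set: T] (EFin \o f) ->
  P.-integrable [set: T] (EFin \o g) ->
  P.-integrable [set: T] (EFin \o (fun w => f w + g w)).
Proof. by move=> fi gi; exact: (integrableD measurableT fi gi). Qed.

Lemma integrable_EFinZ (c : R) f : P.-integrable [set: T] (EFin \o f) ->
  P.-integrable [set: T] (EFin \o (fun w => c * f w)).
Proof. by move=> fi; exact: (integrableZl measurableT c fi). Qed.

Lemma finite_moments_cst (c : R) : cst c \in finite_moments.
Proof.
apply/asboolP; split; first exact: measurable_cst.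
by move=> m; exact: (integrable_EFin_cst (c ^+ m)).
Qed.

Lemma finite_moments_subring : subring_closed finite_moments.
Proof.
split=> [|f g|f g]; first exact: finite_moments_cst.
- move=> /asboolP[mf fm] /asboolP[mg gm]; apply/asboolP.
  have mfg : measurable_fun [set: T] (f - g) by exact: measurable_funB.
  split=> // m.
  (* Passing to the even order [m.*2] lets the dominating function be a sum of moments without
     absolute values. *)
  apply: (@dominated_integrable _
    (fun w => 1 + 2 ^+ m.*2 * (f w ^+ m.*2 + g w ^+ m.*2))).
  + exact: measurable_funX.
  + move=> w; rewrite normrX; apply: le_trans (exprn_le_1D (n := m.*2) _ _) _ => //.
      by rewrite -addnn leq_addr.
    rewrite lerD2l -normrX ger0_norm ?exprn_even_ge0 ?odd_double //.
    case: m => [|m]; first by rewrite !expr0; lra.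
    have := @exprnD_even_le _ (f w) (- g w) m.+1.*2.
    by rewrite odd_double => /(_ isT isT); rewrite exprNn -signr_odd odd_double mul1r.
  + apply: integrable_EFinD; first exact: (integrable_EFin_cst 1).
    by apply: integrable_EFinZ; apply: integrable_EFinD; [exact: fm | exact: gm].
- move=> /asboolP[mf fm] /asboolP[mg gm]; apply/asboolP.
  have mfg : measurable_fun [set: T] (f * g) by exact: measurable_funM.
  split=> // m.
  apply: (@dominated_integrable _ (fun w => f w ^+ m.*2 + g w ^+ m.*2)).
  + exact: measurable_funX.
  + move=> w; rewrite [(f * g) w]/(f w * g w) exprMn -!muln2 !exprM.
    move: (f w ^+ m) (g w ^+ m) => x y; rewrite ler_norml.
    by apply/andP; split; nra.
  + by apply: integrable_EFinD; [exact: fm | exact: gm].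
Qed.

Record moment_rv := MomentRV {
  moment_fun :> T -> R; _ : moment_fun \in finite_moments }.
HB.instance Definition _ := [isSub for moment_fun].
HB.instance Definition _ := [Choice of moment_rv by <:].
HB.instance Definition _ := GRing.isSubringClosed.Build (T -> R)
  finite_moments finite_moments_subring.
HB.instance Definition _ := [SubChoice_isSubComNzRing of moment_rv by <:].

Definition moment_eval (w : T) (f : moment_rv) : R := f w.

Lemma moment_eval_is_zmod_morphism w : zmod_morphism (moment_eval w).
Proof. by []. Qed.

Lemma moment_eval_is_monoid_morphism w : monoid_morphism (moment_eval w).
Proof. by []. Qed.

HB.instance Definition _ w :=
  GRing.isZmodMorphism.Build moment_rv R (moment_eval w)
    (moment_eval_is_zmod_morphism w).
HB.instance Definition _ w :=
  GRing.isMonoidMorphism.Build moment_rv R (moment_eval w)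
    (moment_eval_is_monoid_morphism w).

Definition moment_cst (c : R) : moment_rv := MomentRV (finite_moments_cst c).

Lemma moment_rv_eq (f g : moment_rv) : f =1 g -> f = g.
Proof. by move=> fg; apply/val_inj/funext. Qed.

Lemma moment_cst_is_zmod_morphism : zmod_morphism moment_cst.
Proof. by move=> a b; apply: moment_rv_eq. Qed.

Lemma moment_cst_is_monoid_morphism : monoid_morphism moment_cst.
Proof. by split=> [|a b]; apply: moment_rv_eq. Qed.

HB.instance Definition _ :=
  GRing.isZmodMorphism.Build R moment_rv moment_cst moment_cst_is_zmod_morphism.
HB.instance Definition _ :=
  GRing.isMonoidMorphism.Build R moment_rv moment_cst
    moment_cst_is_monoid_morphism.

Definition moment_mean (f : moment_rv) : R := (\int[P]_w f w)%R.

Lemma moment_rv_integrable (f : moment_rv) : P.-integrable [set: T] (EFin \o f).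
Proof. by case: f => f /= /asboolP[_ /(_ 1%N)]. Qed.

Lemma moment_mean_is_zmod_morphism : zmod_morphism moment_mean.
Proof.
by move=> f g; rewrite /moment_mean -RintegralB //; apply: moment_rv_integrable.
Qed.

HB.instance Definition _ :=
  GRing.isZmodMorphism.Build moment_rv R moment_mean moment_mean_is_zmod_morphism.

Lemma moment_meanZ c (f : moment_rv) :
  moment_mean (moment_cst c * f) = c * moment_mean f.
Proof.
by rewrite /moment_mean -RintegralZl //; apply: moment_rv_integrable.
Qed.

Lemma moment_mean1 : moment_mean 1 = 1.
Proof.
by rewrite /moment_mean Rintegral_cst //= probability_setT mulr1.
Qed.

Lemma moment_mean_ge0 (f : moment_rv) :
  (forall w, 0 <= moment_eval w f) -> 0 <= moment_mean f.
Proof. by move=> f0; apply: Rintegral_ge0 => w _; apply: f0. Qed.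

End FiniteMoments.

(** * From independent events to factorized moments *)

Section IndependentMoments.
Import HBNNSimple.
Context d (T : measurableType d) (R : realType) (P : probability T R).

Lemma integral_simple_limit (h : T -> R) (X : T -> R) (f : R -> R)
    (mf : measurable_fun [set: R] (EFin \o f)) :
  measurable_fun [set: T] h -> (forall w, 0 <= h w) ->
  measurable_fun [set: T] X -> (forall x, 0 <= f x) ->
  (\int[P]_w (h w * f (X w))%:E = limn (fun n =>
    \sum_(k \in range (nnsfun_approx measurableT mf n)) k%:E *
    \int[P]_w (h w * \1_(nnsfun_approx measurableT mf n @^-1` [set k]) (X w))%:E))%E.
Proof.
move=> mh h0 mX f0; set f_ := nnsfun_approx measurableT mf.
have mfX n : measurable_fun [set: T] (f_ n \o X) by exact: measurableT_comp.
transitivity (limn (fun n => \int[P]_w (h w * f_ n (X w))%:E))%E.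
  rewrite -monotone_convergence //.
  - apply: eq_integral => w _; apply/esym/cvg_lim => //.
    under eq_fun do rewrite EFinM; rewrite EFinM.
    apply: cvgeZl => //.
    by apply: (cvg_nnsfun_approx measurableT mf) => //= x _; rewrite lee_fin.
  - move=> n; apply/measurable_EFinP; apply: measurable_funM => //; exact: mfX.
  - by move=> n w _; rewrite lee_fin mulr_ge0.
  - move=> w _ m n mn; rewrite lee_fin ler_wpM2l //.
    exact/lefP/nd_nnsfun_approx.
congr (limn _); apply/funext => n.
have mk k : measurable_fun [set: T] (fun w => h w * \1_(f_ n @^-1` [set k]) (X w)).
  apply: measurable_funM => //; apply: measurableT_comp => //.
transitivity (\int[P]_w \sum_(k \in range (f_ n))
    (k * (h w * \1_(f_ n @^-1` [set k]) (X w)))%:E)%E.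
  apply: eq_integral => w _; rewrite fsumEFin // fimfunE mulr_fsumr //.
  by congr EFin; apply: eq_fsbigr => k _; rewrite mulrCA.
rewrite ge0_integral_fsum //.
- apply: eq_fsbigr => k; rewrite inE => -[x _ <-].
  under eq_integral do rewrite EFinM.
  rewrite ge0_integralZl // ?lee_fin //; first exact/measurable_EFinP.
  by move=> w _; rewrite lee_fin mulr_ge0.
- by move=> k; apply/measurable_EFinP; apply: measurable_funM.
- move=> k w _; rewrite lee_fin.
  rewrite mulrCA mulr_ge0 // indicE.
  by have [|_] := boolP (X w \in _); rewrite ?mulr0 // inE /= mulr1 => <-.
Qed.

(** Replaces conditional expectations: with [h'] constant, a weight [h] that factorizes against the
    events of [X] factorizes against every nonnegative function of [X]. Simple functions and
    monotone convergence pass from events to functions. *)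
Lemma eq_integral_weight (h h' : T -> R) (X : T -> R) (f : R -> R) :
  measurable_fun [set: T] h -> (forall w, 0 <= h w) ->
  measurable_fun [set: T] h' -> (forall w, 0 <= h' w) ->
  measurable_fun [set: T] X ->
  measurable_fun [set: R] f -> (forall x, 0 <= f x) ->
  (forall B, measurable B -> \int[P]_w (h w * \1_B (X w))%:E =
                             \int[P]_w (h' w * \1_B (X w))%:E)%E ->
  (\int[P]_w (h w * f (X w))%:E = \int[P]_w (h' w * f (X w))%:E)%E.
Proof.
move=> mh h0 mh' h'0 mX mf f0 hh'.
have mf' : measurable_fun [set: R] (EFin \o f) by exact/measurable_EFinP.
rewrite !(integral_simple_limit mf') //; congr (limn _); apply/funext => n.
by apply: eq_fsbigr => k _; rewrite hh'.
Qed.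

Context (J : finType) (U : J -> T -> R).
Hypothesis mU : forall j, measurable_fun [set: T] (U j).
Hypothesis Uind : forall B : J -> set R, (forall j, measurable (B j)) ->
  P (\bigcap_(j in [set: J]) (U j @^-1` B j)) =
  (\prod_j fine (P (U j @^-1` B j)))%:E.

Let mpre j B : measurable B -> measurable (U j @^-1` B).
Proof. by move=> mB; rewrite -[_ @^-1` _]setTI; exact: mU. Qed.

(* Indicators are replaced by arbitrary functions one variable at a time. *)
Lemma integral_prod_independent_ge0 (r : seq J) : uniq r ->
  forall (g : J -> R -> R) (B : J -> set R) (e : J -> R),
  (forall j, measurable_fun [set: R] (g j)) -> (forall j x, 0 <= g j x) ->
  (forall j, measurable (B j)) -> (forall j, j \notin r -> g j = \1_(B j)) ->
  (forall j, \int[P]_w (g j (U j w))%:E = (e j)%:E)%E ->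
  (\int[P]_w (\prod_j g j (U j w))%:E = (\prod_j e j)%:E)%E.
Proof.
elim: r => [_|j0 r IH /= /andP[j0r ur]] g B e mg g0 mB gB ge.
  have gE j : g j = \1_(B j) by exact: gB.
  have eE j : e j = fine (P (U j @^-1` B j)).
    apply: EFin_inj; rewrite -ge fineK ?fin_num_measure //; last exact: mpre.
    transitivity (\int[P]_w (\1_(U j @^-1` B j) w)%:E)%E.
      by apply: eq_integral => w _; rewrite gE !indicE.
    by rewrite integral_indic ?setIT //; exact: mpre.
  under eq_bigr do rewrite eE.
  rewrite -Uind //.
  transitivity (\int[P]_w (\1_(\bigcap_(j in [set: J]) (U j @^-1` B j)) w)%:E)%E.
    apply: eq_integral => w _; congr EFin; rewrite indicE.
    under eq_bigr do rewrite gE indicE.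
    have [win|wout] := boolP (w \in _).
      by rewrite big1 // => j _; rewrite mem_set //; move: win; rewrite inE; exact.
    have /existsNP[j Uj] : ~ forall j, B j (U j w).
      by move=> Bw; move: wout; rewrite notin_setE; apply => j _; exact: Bw.
    by rewrite (bigD1 j) //= memNset // mul0r.
  rewrite integral_indic ?setIT //.
  by apply: fin_bigcap_measurable => // j _; exact: mpre.
have e0 j : 0 <= e j.
  by rewrite -lee_fin -ge; apply: integral_ge0 => w _; rewrite lee_fin.
rewrite [in RHS](bigD1 j0) //=.
under eq_integral do rewrite (bigD1 j0) //= mulrC.
have mprod : measurable_fun [set: T] (fun w => \prod_(j | j != j0) g j (U j w)).
  under eq_fun do rewrite -big_filter.
  by apply: measurable_prod => j _; apply: measurableT_comp.
rewrite (@eq_integral_weight _ (cst (\prod_(j | j != j0) e j))) //.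
- under eq_integral do rewrite /= EFinM.
  rewrite ge0_integralZl //.
  + by rewrite ge -EFinM mulrC.
  + by apply/measurable_EFinP; apply: measurableT_comp.
  + by move=> w _; rewrite lee_fin.
  + by rewrite lee_fin prodr_ge0.
- by move=> w; rewrite prodr_ge0.
- by move=> w; rewrite prodr_ge0.
move=> C mC; under [RHS]eq_integral do rewrite /= EFinM.
rewrite ge0_integralZl //; last 2 first.
- by apply/measurable_EFinP; apply: measurableT_comp.
- by rewrite lee_fin prodr_ge0.
have iC : (\int[P]_w (\1_C (U j0 w))%:E = (fine (P (U j0 @^-1` C)))%:E)%E.
  rewrite fineK ?fin_num_measure //; last exact: mpre.
  transitivity (\int[P]_w (\1_(U j0 @^-1` C) w)%:E)%E.
    by apply: eq_integral => w _; rewrite !indicE.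
  by rewrite integral_indic ?setIT //; exact: mpre.
rewrite /= iC -EFinM.
(* With an indicator at [j0], one arbitrary function fewer remains and the induction hypothesis
   applies. *)
pose g' j := if j == j0 then \1_C else g j.
pose B' j := if j == j0 then C else B j.
pose e' j := if j == j0 then fine (P (U j0 @^-1` C)) else e j.
transitivity (\int[P]_w (\prod_j g' j (U j w))%:E)%E.
  apply: eq_integral => w _; congr EFin; rewrite [RHS](bigD1 j0) //= /g' eqxx mulrC.
  by congr (_ * _); apply: eq_bigr => j /negbTE ->.
rewrite (IH ur g' B' e').
- rewrite (bigD1 j0) //= /e' eqxx mulrC; congr (_ * _)%:E.
  by apply: eq_bigr => j /negbTE ->.
- by move=> j; rewrite /g'; case: ifP => // _; exact: measurable_indic.
- by move=> j x; rewrite /g'; case: ifP => // _.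
- by move=> j; rewrite /B'; case: ifP.
- move=> j jr; rewrite /g' /B'; case: ifPn => // jj0.
  by apply: gB; rewrite inE negb_or jj0.
- by move=> j; rewrite /g' /e'; case: ifP => [/eqP -> //|_]; exact: ge.
Qed.

End IndependentMoments.

Section MomentIndependence.
Context d (T : measurableType d) (R : realType) (P : probability T R).

Lemma moment_rv_measurable (f : moment_rv P) : measurable_fun [set: T] f.
Proof. by case: f => f /= /asboolP[]. Qed.

Lemma moment_rvX (f : moment_rv P) m w : (f ^+ m) w = f w ^+ m.
Proof. exact: (rmorphXn (moment_eval w)). Qed.

Lemma finite_moments_le (f : moment_rv P) (g : T -> R) :
  measurable_fun [set: T] g -> (forall w, `|g w| <= `|f w|) ->
  g \in finite_moments P.
Proof.
move=> mg gf; apply/asboolP; split=> // m.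
apply: (@dominated_integrable _ _ _ _ _ (fun w => `|(f ^+ m) w|)).
- exact: measurable_funX.
- move=> w; rewrite moment_rvX !normrX.
  by apply: lerXn2r; rewrite ?nnegrE.
- exact/integrable_norm/moment_rv_integrable.
Qed.

Lemma moment_meanE (f : moment_rv P) :
  (\int[P]_w (f w)%:E = (moment_mean f)%:E)%E.
Proof.
rewrite /moment_mean /Rintegral fineK //; apply: integrable_fin_num => //.
exact: moment_rv_integrable.
Qed.

Lemma moment_rv_prod (J : finType) (V : J -> moment_rv P) w :
  (\prod_j V j) w = \prod_j V j w.
Proof. exact: (rmorph_prod (moment_eval w)). Qed.

(** Powers are signed while factorization is available for nonnegative functions only: each power is
    split into positive and negative parts, and the product is expanded over all choices of sign. *)
Lemma independent_moments (J : finType) (U : J -> moment_rv P) :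
  (forall B : J -> set R, (forall j, measurable (B j)) ->
    P (\bigcap_(j in [set: J]) (U j @^-1` B j)) =
    (\prod_j fine (P (U j @^-1` B j)))%:E) ->
  moment_independent (@moment_mean _ _ _ P) U.
Proof.
move=> Uind m.
have mU j := moment_rv_measurable (U j).
pose f j (b : bool) (x : R) := Num.max (if b then x ^+ m j else - x ^+ m j) 0.
have mf j b : measurable_fun [set: R] (f j b).
  apply: measurable_maxr => //; case: b; first exact: measurable_funX.
  by apply: measurable_funN; exact: measurable_funX.
have f0 j b x : 0 <= f j b x by rewrite le_max lexx orbT.
have fmom j b : f j b \o U j \in finite_moments P.
  apply: (@finite_moments_le (U j ^+ m j)); first exact: measurableT_comp.
  move=> w; rewrite moment_rvX /= ger0_norm // ge_max normr_ge0 andbT.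
  by case: b; rewrite ?ler_norm // -normrN ler_norm.
pose V j b := MomentRV (fmom j b).
have decomp (x : R) : x = 1 * Num.max x 0 + -1 * Num.max (- x) 0.
  rewrite mul1r mulN1r; case/orP: (le_total 0 x) => x0.
    by rewrite (max_l x0) max_r ?oppr_le0 // subr0.
  by rewrite (max_r x0) max_l ?oppr_ge0 // sub0r opprK.
have UV j : U j ^+ m j = \sum_(b : bool) moment_cst P ((-1) ^+ (~~ b)) * V j b.
  rewrite big_bool; apply: moment_rv_eq => w; rewrite moment_rvX.
  exact: decomp.
have VE (s : {ffun J -> bool}) :
    moment_mean (\prod_j V j (s j)) = \prod_j moment_mean (V j (s j)).
  apply: EFin_inj; rewrite -moment_meanE.
  under eq_integral do rewrite moment_rv_prod.
  apply: (integral_prod_independent_ge0 mU Uind (r := enum J) (enum_uniq J)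
    (g := fun j => f j (s j)) (B := fun=> setT)) => //.
    by move=> j; rewrite mem_enum.
  by move=> j; exact: (moment_meanE (V j (s j))).
under eq_bigr do rewrite UV.
rewrite bigA_distr_bigA raddf_sum /=.
transitivity (\sum_(s : {ffun J -> bool})
    \prod_j ((-1) ^+ (~~ s j) * moment_mean (V j (s j)))).
  apply: eq_bigr => s _; rewrite big_split /= -(rmorph_prod (@moment_cst _ _ _ P)).
  by rewrite moment_meanZ VE big_split.
rewrite -(bigA_distr_bigA (fun j b => (-1) ^+ (~~ b) * moment_mean (V j b))).
apply: eq_bigr => j _; rewrite UV raddf_sum; apply: eq_bigr => b _.
by rewrite -moment_meanZ.
Qed.

End MomentIndependence.

(** * Moments of sub-exponential variables *)

Section SubExponentialMoments.
Context d (T : measurableType d) (R : realType) (P : probability T R).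
Context (alpha : R) (X : {RV P >-> R}).
Hypothesis alpha0 : 0 < alpha.

Definition exp_moment (t : R) : \bar R :=
  (\int[P]_w (expR (`|X w| `^ alpha / t `^ alpha))%:E)%E.

Lemma measurable_exp_power (t : R) :
  measurable_fun [set: T] (fun w => expR (`|X w| `^ alpha / t `^ alpha)).
Proof.
apply: measurableT_comp => //; apply: measurable_funM => //.
apply: (measurableT_comp (measurable_powR alpha)).
exact: measurableT_comp.
Qed.

(** The scale [t] doubles the exponent of the tail. On the layer where the normalized power lies in
    [[k, k + 1)] the integrand is at most [exp (k + 1)], against a probability at most
    [2 * exp (- 2 * k)]; the layers sum to at most [4 * expR 1]. *)
Lemma exp_moment_finite : sub_exponential alpha X ->
  exists2 t : R, 0 < t & exists C : R, (exp_moment t <= C%:E)%E.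
Proof.
move=> [K K0 tail]; exists (K * 2 `^ alpha^-1).
  by rewrite mulr_gt0 // powR_gt0.
set t := K * _; have t0 : 0 < t by rewrite mulr_gt0 // powR_gt0.
have tK : t `^ alpha = 2 * K `^ alpha.
  by rewrite /t powRM ?powR_ge0 ?(ltW K0) // -powRrM mulVf ?gt_eqF // powRr1 // mulrC.
have Ka0 : 0 < K `^ alpha by rewrite powR_gt0.
have ta0 : 0 < t `^ alpha by rewrite powR_gt0.
pose A k := [set w | t * k%:R `^ alpha^-1 <= `|X w|].
have mnX : measurable_fun [set: T] (fun w => `|X w|) by exact: measurableT_comp.
have mA k : measurable (A k).
  have := mnX measurableT _ (measurable_itv `[t * k%:R `^ alpha^-1, +oo[%R).
  by rewrite setTI preimage_itvcy.
have PA k : (P (A k) <= (2 * expR (- (2 * k%:R)))%:E)%E.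
  apply: le_trans (tail _ _) _; first by rewrite mulr_ge0 ?powR_ge0 ?(ltW t0).
  rewrite powRM ?powR_ge0 ?(ltW t0) // -powRrM mulVf ?gt_eqF // powRr1 // tK.
  by rewrite mulrAC mulrK ?unitfE ?gt_eqF.
pose g k w : \bar R := ((expR k.+1%:R)%:E * (\1_(A k) w)%:E)%E.
have g0 k w : (0 <= g k w)%E by rewrite /g -EFinM lee_fin mulr_ge0 ?expR_ge0.
have mg k : measurable_fun [set: T] (g k).
  apply/measurable_EFinP; apply: measurable_funM => //.
have pointwise w : ((expR (`|X w| `^ alpha / t `^ alpha))%:E <=
    \sum_(0 <= k <oo) g k w)%E.
  set Y := _ / _; have Y0 : 0 <= Y by rewrite divr_ge0 ?powR_ge0.
  have /andP[kY Yk] := Num.Theory.truncn_itv Y0; set k := Num.truncn Y in kY Yk.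
  apply: le_trans (nneseries_lim_ge k.+1 (fun n _ _ => g0 n w)).
  rewrite big_nat_recr //= -[leLHS]add0e; apply: leeD; first exact: sume_ge0.
  rewrite /g indicE mem_set ?mule1 ?lee_fin ?ler_expR ?(ltW Yk) // /A /=.
  have -> : `|X w| = (Y * t `^ alpha) `^ alpha^-1.
    by rewrite divfK ?gt_eqF // -powRrM mulfV ?gt_eqF // powRr1.
  rewrite powRM ?powR_ge0 // -powRrM mulfV ?gt_eqF // powRr1 ?(ltW t0) // mulrC.
  rewrite ler_wpM2r ?(ltW t0) // ge0_ler_powR ?nnegrE //.
  by rewrite invr_ge0 ltW.
exists (4 * expR 1).
apply: (@le_trans _ _ (\int[P]_w \sum_(0 <= k <oo) g k w)%E).
  apply: ge0_le_integral => //.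
  - by apply/measurable_EFinP; exact: measurable_exp_power.
  - by apply: ge0_emeasurable_sum.
rewrite integral_nneseries //.
have intg k : (\int[P]_w g k w <= (2 * expR 1 * 2^-1 ^+ k)%:E)%E.
  rewrite /g ge0_integralZl ?lee_fin ?expR_ge0 //; last exact/measurable_EFinP.
  rewrite integral_indic // setIT.
  apply: (@le_trans _ _ ((expR k.+1%:R)%:E * (2 * expR (- (2 * k%:R)))%:E)%E).
    by apply: lee_wpmul2l; [rewrite lee_fin expR_ge0 | exact: PA].
  rewrite -EFinM lee_fin mulrCA -mulrA ler_wpM2l // -expRD.
  have -> : k.+1%:R + - (2 * k%:R) = 1 + - 1 * k%:R :> R by rewrite -natr1; ring.
  rewrite expRD ler_wpM2l ?expR_ge0 // expRM_natr.
  apply: lerXn2r; rewrite ?nnegrE ?expR_ge0 //.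
  rewrite expRN lef_pV2 ?posrE ?expR_gt0 //.
  by apply: le_trans (expR_ge1Dx 1); lra.
apply: lime_le; first by apply: is_cvg_nneseries => k _ _; exact: integral_ge0.
apply: nearW => n; apply: (@le_trans _ _ (\sum_(0 <= k < n) (2 * expR 1 * 2^-1 ^+ k)%:E)%E).
  exact: lee_sum.
rewrite sumEFin lee_fin -mulr_sumr.
rewrite (_ : 4 * expR 1 = 2 * expR 1 * 2); last by ring.
by rewrite ler_wpM2l ?mulr_ge0 ?expR_ge0 // geometric_half_le.
Qed.

Definition psi_set := [set t : R | 0 < t /\
    ('E_P[fun w => expR (`|X w| `^ alpha / t `^ alpha)] <= 2%:E)%E].

Lemma exp_momentE t :
  ('E_P[fun w => expR (`|X w| `^ alpha / t `^ alpha)] = exp_moment t)%E.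
Proof. by rewrite unlock. Qed.

(* Without this, [psi_norm] could be the junk value [inf set0 = 0]. *)
Lemma psi_set_nonempty : sub_exponential alpha X -> psi_set !=set0.
Proof.
move=> /exp_moment_finite[t t0 [C tC]].
have ta0 : 0 < t `^ alpha by rewrite powR_gt0.
pose s := (Num.truncn C).+1; have sC : C <= s%:R by rewrite ltW // truncnS_gt.
have s0 : 0 < s%:R :> R by rewrite ltr0n.
(* The new scale divides the exponent [Y] by [s]. Bernoulli's inequality gives
   [exp (Y / s) <= 1 + exp Y / s], whose mean is at most [1 + C / s <= 2]. *)
exists (t * s%:R `^ alpha^-1); split; first by rewrite mulr_gt0 ?powR_gt0.
rewrite exp_momentE /exp_moment.
rewrite powRM ?powR_ge0 ?(ltW t0) // -powRrM mulVf ?gt_eqF // powRr1 ?(ltW s0) //.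
apply: (@le_trans _ _ (\int[P]_w (1 +
    s%:R^-1 * expR (`|X w| `^ alpha / t `^ alpha))%:E)%E).
  apply: ge0_le_integral => //.
  - apply/measurable_EFinP; apply: measurableT_comp => //.
    apply: measurable_funM => //; apply: (measurableT_comp (measurable_powR alpha)).
    exact: measurableT_comp.
  - apply/measurable_EFinP; apply: measurable_funD => //.
    by apply: measurable_funM => //; exact: measurable_exp_power.
  move=> w _; rewrite lee_fin invfM mulrA; set Y := _ / t `^ alpha.
  have Y0 : 0 <= Y by rewrite divr_ge0 ?powR_ge0.
  have bern m : 1 + m%:R * (expR (Y / s%:R) - 1) <= expR (Y / s%:R) ^+ m.
    have e1 : 1 <= expR (Y / s%:R).
      by rewrite -expR0 ler_expR divr_ge0 // ltW.
    elim: m => [|m IH]; first by rewrite mul0r addr0 expr0.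
    rewrite exprS; apply: le_trans (ler_wpM2l (le_trans ler01 e1) IH).
    rewrite -subr_ge0 [leRHS](_ : _ = m%:R * (expR (Y / s%:R) - 1) ^+ 2).
      by rewrite mulr_ge0 // exprn_even_ge0.
    by rewrite -natr1; ring.
  have := bern s; rewrite -expRM_natr divfK ?gt_eqF // => h.
  rewrite -lerBlDl -[leRHS]mulrC ler_pdivlMr // mulrC.
  by apply: le_trans h; rewrite lerDr.
under eq_integral do rewrite EFinD EFinM.
rewrite ge0_integralD //; last first.
  by apply/measurable_EFinP; apply: measurable_funM => //; exact: measurable_exp_power.
rewrite ge0_integralZl ?lee_fin ?invr_ge0 ?(ltW s0) //; last first.
  by apply/measurable_EFinP; exact: measurable_exp_power.
rewrite integral_cst //= probability_setT mule1.
apply: (@le_trans _ _ (1%:E + (s%:R^-1)%:E * C%:E)%E).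
  by apply: leeD2l; apply: lee_wpmul2l; rewrite ?lee_fin ?invr_ge0 ?(ltW s0).
rewrite -EFinM -EFinD lee_fin (_ : 2 = 1 + 1); last by [].
by rewrite lerD2l mulrC ler_pdivrMr // mul1r.
Qed.

(** The strict inequality yields a member of [psi_set] below [t], and the exponential moment
    decreases in the scale. This strictness is why [2 * L] serves as scale later. *)
Lemma exp_moment_le2 t : sub_exponential alpha X -> 0 < t ->
  psi_norm alpha X < t -> (exp_moment t <= 2%:E)%E.
Proof.
move=> /psi_set_nonempty psi0 t0 /(inf_lt psi0)[u [u0 hu] ut].
rewrite exp_momentE in hu; apply: le_trans hu.
apply: ge0_le_integral => //.
- by apply/measurable_EFinP; exact: measurable_exp_power.
- by apply/measurable_EFinP; exact: measurable_exp_power.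
move=> w _; rewrite lee_fin ler_expR ler_wpM2l ?powR_ge0 //.
rewrite lef_pV2 ?posrE ?powR_gt0 //.
by rewrite ge0_ler_powR ?nnegrE ?(ltW u0) ?(ltW t0) ?(ltW ut) ?(ltW alpha0).
Qed.

(** With [v] the exponent and [c = m / alpha], this is [v ^ c <= c ^ c * exp v], which follows from
    [v / c <= exp (v / c)]. *)
Lemma exprn_le_exp_power (t x : R) m : 0 < t -> 0 <= x -> (0 < m)%N ->
  x ^+ m <= (t * (m%:R / alpha) `^ alpha^-1) ^+ m * expR (x `^ alpha / t `^ alpha).
Proof.
move=> t0 x0 m0; have ta0 : 0 < t `^ alpha by rewrite powR_gt0.
set v := _ / t `^ alpha; have v0 : 0 <= v by rewrite divr_ge0 ?powR_ge0.
have mR : 0 < m%:R :> R by rewrite ltr0n.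
set c := m%:R / alpha; have c0 : 0 < c by rewrite divr_gt0.
have vc0 : 0 <= v / c by rewrite divr_ge0 // ltW.
have root y : 0 <= y -> (y `^ alpha) `^ alpha^-1 = y.
  by move=> y0; rewrite -powRrM mulfV ?gt_eqF // powRr1.
have xE : x = t * v `^ alpha^-1.
  rewrite -[LHS]root // -[x `^ alpha](divfK (_ : t `^ alpha != 0)) ?gt_eqF //.
  by rewrite powRM ?powR_ge0 // root ?(ltW t0) // mulrC.
have power y : 0 <= y -> (y `^ alpha^-1) ^+ m = y `^ c.
  by move=> y0; rewrite -powR_mulrn ?powR_ge0 // -powRrM mulrC.
rewrite [in leLHS]xE !exprMn -mulrA ler_wpM2l ?exprn_ge0 ?(ltW t0) //.
rewrite !power ?(ltW c0) //.
rewrite (_ : v `^ c = c `^ c * (v / c) `^ c); last first.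
  by rewrite -(powRM _ (ltW c0) vc0) [c * _]mulrC divfK ?gt_eqF.
rewrite ler_wpM2l ?powR_ge0 //.
have -> : expR v = expR (v / c) `^ c by rewrite -expRM divfK ?gt_eqF.
apply: ge0_ler_powR; rewrite ?nnegrE ?expR_ge0 ?vc0 ?(ltW c0) //.
by apply: le_trans (expR_ge1Dx _); rewrite lerDr.
Qed.

Lemma sub_exponential_integrable t m : sub_exponential alpha X -> 0 < t ->
  psi_norm alpha X < t -> (0 < m)%N ->
  (\int[P]_w (`|X w| ^+ m)%:E <=
    (2 * (t * (m%:R / alpha) `^ alpha^-1) ^+ m)%:E)%E.
Proof.
move=> Xsub t0 Xt m0; set D := _ ^+ m.
have D0 : 0 <= D by rewrite exprn_ge0 // mulr_ge0 ?powR_ge0 ?(ltW t0).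
apply: (@le_trans _ _ (\int[P]_w (D * expR (`|X w| `^ alpha / t `^ alpha))%:E)%E).
  apply: ge0_le_integral => //.
  - by apply/measurable_EFinP; apply: measurable_funX; exact: measurableT_comp.
  - by apply/measurable_EFinP; apply: measurable_funM => //; exact: measurable_exp_power.
  by move=> w _; rewrite lee_fin exprn_le_exp_power.
under eq_integral do rewrite EFinM.
rewrite ge0_integralZl ?lee_fin //; last first.
  by apply/measurable_EFinP; exact: measurable_exp_power.
rewrite mulrC EFinM; apply: lee_wpmul2l; first by rewrite lee_fin.
exact: exp_moment_le2.
Qed.

Lemma sub_exponential_finite_moments : sub_exponential alpha X ->
  (X : T -> R) \in finite_moments P.
Proof.
move=> Xsub; apply/asboolP; split=> // -[|m].
  under eq_fun do rewrite expr0; exact: (integrable_EFin_cst P 1).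
pose t := Num.max 1 (psi_norm alpha X + 1).
have t0 : 0 < t by rewrite lt_max ltr01.
have Xt : psi_norm alpha X < t by rewrite lt_max ltrDl ltr01 orbT.
apply/integrableP; split.
  by apply/measurable_EFinP; exact: measurable_funX.
under eq_integral do rewrite abse_EFin normrX.
by apply: le_lt_trans (sub_exponential_integrable Xsub t0 Xt (ltn0Sn m)) _; rewrite ltry.
Qed.

End SubExponentialMoments.

(** * The normalized sparse variables and their moment bounds *)

Section SparseFamily.
Context d (T : measurableType d) (R : realType) (P : probability T R).

Lemma g_sigma_preimage_bigcap n (Y : 'I_n -> {RV P >-> R}) (C : 'I_n -> set R) :
  (forall i, measurable (C i)) ->
  g_sigma_preimage (fun i => Y i : T -> R)
    (\bigcap_(i in [set: 'I_n]) (Y i @^-1` C i)).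
Proof.
move=> mC; set G := \big[setU/set0]_(i < n)
  preimage_set_system [set: T] (Y i) measurable.
apply: (@fin_bigcap_measurable _ (g_sigma_algebraType G)) => // i _.
apply: sub_gen_smallest; rewrite /G -bigcup_seq.
by exists i => /=; [rewrite mem_index_enum | exists (C i); rewrite ?setTI].
Qed.

Context (n : nat) (p : 'I_n -> R) (delta zeta : 'I_n -> {RV P >-> R}) (alpha L : R).
Hypothesis alpha0 : 0 < alpha.
Hypothesis delta_p : forall i, bernoulli_rv (p i) (delta i).
Hypothesis delta_ind : mutually_independent delta.
Hypothesis zeta_sub : forall i, sub_exponential alpha (zeta i).
Hypothesis zeta_centered : forall i, ('E_P[zeta i] = 0)%E.
Hypothesis zeta_ind : mutually_independent zeta.
Hypothesis delta_zeta : independent_families delta zeta.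
Hypothesis L0 : 0 < L.
Hypothesis psi_L : forall i, psi_norm alpha (zeta i) < 2 * L.

(* [delta i] is only almost surely in {0, 1}; its indicator version has this
   property everywhere, and in particular all moments. *)
Lemma selector_finite_moments i :
  (\1_[set 1] \o delta i : T -> R) \in finite_moments P.
Proof.
apply: (@finite_moments_le _ _ _ _ 1).
  by apply: measurableT_comp => //; exact: measurable_indic.
move=> w /=; rewrite [X in _ <= `|X|](_ : _ = 1) // indicE normr1.
by case: (_ \in _); rewrite ?normr1 ?normr0.
Qed.

Definition selector i : moment_rv P := MomentRV (selector_finite_moments i).

Definition zeta_rv i : moment_rv P :=
  MomentRV (sub_exponential_finite_moments alpha0 (zeta_sub i)).

Definition joint_family (j : 'I_n + 'I_n) : moment_rv P :=
  match j with inl i => selector i | inr i => zeta_rv i end.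

Definition sparse_rv i : moment_rv P :=
  moment_cst P L^-1 * selector i * zeta_rv i.

Lemma joint_family_poly_in j :
  poly_in (@moment_cst _ _ _ P) joint_family [set j]%SET (joint_family j).
Proof. by apply: poly_in_gen; rewrite finset.inE. Qed.

(** Independence within each family and between the two gives joint independence of all [2 * n]
    variables. Events of a selector are pulled back to events of [delta i]. *)
Lemma joint_family_independent : moment_independent (@moment_mean _ _ _ P) joint_family.
Proof.
apply: independent_moments => B mB.
pose C i : set R := \1_[set 1] @^-1` B (inl i).
have mC i : measurable (C i).
  have m1 : measurable_fun [set: R] (\1_[set 1] : R -> R).
    exact: measurable_indic.
  by rewrite -[C i]setTI; apply: m1.
have -> : \bigcap_(j in [set: 'I_n + 'I_n]) (joint_family j @^-1` B j) =
    (\bigcap_(i in [set: 'I_n]) (delta i @^-1` C i)) `&`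
    (\bigcap_(i in [set: 'I_n]) (zeta i @^-1` B (inr i))).
  apply/seteqP; split => [w Bw|w [w1 w2] [i|i] _].
  - by split=> i _; [exact: (Bw (inl i)) | exact: (Bw (inr i))].
  - exact: w1.
  - exact: w2.
rewrite delta_zeta; [|exact: g_sigma_preimage_bigcap..].
rewrite delta_ind // zeta_ind //.
rewrite big_sumType /= EFinM -!prodEFin.
have finP (Y : {RV P >-> R}) (D : set R) : measurable D ->
    (fine (P (Y @^-1` D)))%:E = P (Y @^-1` D).
  move=> mD; rewrite fineK // fin_num_measure //.
  by rewrite -[_ @^-1` _]setTI; exact: measurable_funPT.
by congr (_ * _)%E; apply: eq_bigr => i _; rewrite -finP.
Qed.

Lemma sparse_rv_independent : moment_independent (@moment_mean _ _ _ P) sparse_rv.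
Proof.
move=> m.
pose V j : moment_rv P := match j with
  | inl i => (moment_cst P L^-1 * selector i) ^+ m i
  | inr i => zeta_rv i ^+ m i end.
have Vp j : poly_in (@moment_cst _ _ _ P) joint_family [set j]%SET (V j).
  case: j => i; apply: poly_inX; last exact: (joint_family_poly_in (inr i)).
  apply: poly_inM; first exact: poly_in_cst.
  exact: (joint_family_poly_in (inl i)).
have Vprod := moment_independent_prod (@moment_meanZ _ _ _ P)
  (@moment_mean1 _ _ _ P) joint_family_independent.
transitivity (moment_mean (\prod_j V j)).
  congr moment_mean; rewrite big_sumType /= -big_split /=.
  by apply: eq_bigr => i _; rewrite exprMn.
rewrite Vprod // big_sumType /= -big_split /=; apply: eq_bigr => i _.
rewrite /sparse_rv [in RHS]exprMn; symmetry; apply: (moment_independentM (@moment_meanZ _ _ _ P)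
  (@moment_mean1 _ _ _ P) joint_family_independent _ (Vp (inl i)) (Vp (inr i))).
by rewrite disjoints1 inE.
Qed.

(** Idempotence is what leaves a single factor [p i] in every moment of [sparse_rv]. *)
Lemma selectorX i m : (0 < m)%N -> selector i ^+ m = selector i.
Proof.
case: m => // m _; apply: moment_rv_eq => w; rewrite moment_rvX /= indicE.
by case: (_ \in _); rewrite ?expr1n ?expr0n.
Qed.

Lemma selector_mean i : moment_mean (selector i) = p i.
Proof.
apply: EFin_inj; rewrite -moment_meanE.
have [_ _ <-] := delta_p i.
transitivity (\int[P]_w (\1_[set w | delta i w = 1] w)%:E)%E.
  by apply: eq_integral => w _; congr EFin; rewrite /= !indicE; congr (_%:R);
     apply/idP/idP; rewrite !inE.
rewrite integral_indic // ?setIT //.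
rewrite -[X in measurable X]setTI.
exact: (measurable_funPT (delta i) measurableT _ (measurable_set1 1)).
Qed.

Lemma sparse_rv_moment i m : (0 < m)%N -> moment_mean (sparse_rv i ^+ m) =
  L^-1 ^+ m * p i * moment_mean (zeta_rv i ^+ m).
Proof.
move=> m0; rewrite /sparse_rv !exprMn selectorX // -rmorphXn -mulrA moment_meanZ.
rewrite -mulrA; congr (_ * _).
rewrite -selector_mean; apply: (moment_independentM (@moment_meanZ _ _ _ P)
  (@moment_mean1 _ _ _ P) joint_family_independent _
  (joint_family_poly_in (inl i)) (poly_inX m (joint_family_poly_in (inr i)))).
by rewrite disjoints1 finset.inE.
Qed.

(** In the constant, one [2] is the scale [2 * L] divided by [L], the other absorbs the prefactor
    [2 <= 2 ^+ m]; the power of [alpha^-1] is split off from [m / alpha]. *)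
Lemma sparse_rv_bound : moment_bound (@moment_mean _ _ _ P) sparse_rv p
  (4 * alpha^-1 `^ alpha^-1) alpha^-1.
Proof.
move=> i; have [/andP[p0 _] _ _] := delta_p i; split.
  have := @sparse_rv_moment i 1%N isT; rewrite !expr1 => mean_eq; apply: etrans mean_eq _.
  rewrite (_ : moment_mean (zeta_rv i) = 0) ?mulr0 //.
  by apply: EFin_inj; rewrite -moment_meanE; have := zeta_centered i; rewrite unlock.
move=> m m1; have m0 : (0 < m)%N by apply: ltn_trans m1.
rewrite [X in `|X|](sparse_rv_moment i m0) !normrM (ger0_norm p0) normrX.
rewrite ger0_norm ?invr_ge0 ?(ltW L0) // mulrAC mulrC ler_wpM2l //.
have L20 : 0 < 2 * L by rewrite mulr_gt0.
have zm : `|moment_mean (zeta_rv i ^+ m)| <=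
    2 * (2 * L * (m%:R / alpha) `^ alpha^-1) ^+ m.
  rewrite -lee_fin -abse_EFin -moment_meanE.
  apply: le_trans (le_abse_integral _ _ _) _ => //.
    by apply/measurable_EFinP; exact: moment_rv_measurable.
  apply: le_trans _ (sub_exponential_integrable alpha0 (zeta_sub i) L20 (psi_L i) m0).
  apply: ge0_le_integral => //.
  - by apply: measurableT_comp => //; apply/measurable_EFinP; exact: moment_rv_measurable.
  - by apply/measurable_EFinP; apply: measurable_funX; exact: measurableT_comp.
  by move=> w _; rewrite abse_EFin lee_fin moment_rvX normrX.
rewrite mulrC; apply: le_trans (ler_wpM2r _ zm) _.
  by rewrite exprn_ge0 // invr_ge0 ltW.
rewrite -[leLHS]mulrA -exprMn.
have -> : 2 * L * (m%:R / alpha) `^ alpha^-1 * L^-1 =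
    2 * alpha^-1 `^ alpha^-1 * m%:R `^ alpha^-1.
  by rewrite powRM ?invr_ge0 ?(ltW alpha0) //; field; rewrite gt_eqF.
rewrite [in leRHS](_ : 4 * _ * _ =
  2 * (2 * alpha^-1 `^ alpha^-1 * m%:R `^ alpha^-1)); last by ring.
rewrite [leRHS]exprMn ler_wpM2r //.
  by rewrite exprn_ge0 // !mulr_ge0 ?powR_ge0.
by rewrite -[leLHS]expr1 ler_weXn2l // ler1n.
Qed.

End SparseFamily.

(** * The rate and the tail bound *)

Section OperatorNorm.
Context (R : realType).

Lemma l2_norm_ge0 n (x : 'cV[R]_n) : 0 <= l2_norm x.
Proof. exact: sqrtr_ge0. Qed.

Lemma l2_norm_sqr n (x : 'cV[R]_n) : l2_norm x ^+ 2 = \sum_i x i 0 ^+ 2.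
Proof. by rewrite sqr_sqrtr // sumr_ge0 // => i _; rewrite exprn_even_ge0. Qed.

Lemma l2_normZ n c (x : 'cV[R]_n) : 0 <= c -> l2_norm (c *: x) = c * l2_norm x.
Proof.
move=> c0; rewrite /l2_norm -[in RHS](ger0_norm c0) -sqrtr_sqr.
rewrite -sqrtrM ?exprn_even_ge0 //; congr Num.sqrt.
by rewrite mulr_sumr; apply: eq_bigr => i _; rewrite mxE exprMn.
Qed.

(** Provides the upper bound that makes the supremum in [l2_op_norm] a genuine one. *)
Lemma l2_norm_mulmx_frobenius m n (M : 'M[R]_(m, n)) (x : 'cV[R]_n) :
  l2_norm x <= 1 -> l2_norm (M *m x) <= Num.sqrt (\sum_i \sum_j M i j ^+ 2).
Proof.
move=> x1; rewrite ler_wsqrtr //; apply: ler_sum => i _; rewrite mxE.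
have := @weighted_CS _ _ (fun=> 1) (fun j => M i j) (fun j => x j 0).
under eq_bigr do rewrite mul1r.
under [X in _ -> _ <= X * _]eq_bigr do rewrite mul1r.
under [X in _ -> _ <= _ * X]eq_bigr do rewrite mul1r.
move=> /(_ (fun=> ler01)) /le_trans; apply.
rewrite -l2_norm_sqr -[leRHS]mulr1 ler_wpM2l ?expr_le1 ?l2_norm_ge0 //.
by rewrite sumr_ge0 // => j _; rewrite exprn_even_ge0.
Qed.

Lemma l2_op_norm_ge m n (M : 'M[R]_(m, n)) (x : 'cV[R]_n) :
  l2_norm x <= 1 -> l2_norm (M *m x) <= l2_op_norm M.
Proof.
move=> x1; apply: ub_le_sup; last by exists x.
exists (Num.sqrt (\sum_i \sum_j M i j ^+ 2)) => _ [y y1 <-].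
exact: l2_norm_mulmx_frobenius.
Qed.

Lemma l2_op_norm_ge0 m n (M : 'M[R]_(m, n)) : 0 <= l2_op_norm M.
Proof.
apply: le_trans (l2_op_norm_ge M (x := 0) _); first exact: l2_norm_ge0.
by rewrite /l2_norm big1 ?sqrtr0 ?ler01 // => i _; rewrite mxE expr0n.
Qed.

Lemma l2_norm_mulmx_le m n (M : 'M[R]_(m, n)) (x : 'cV[R]_n) :
  l2_norm (M *m x) <= l2_op_norm M * l2_norm x.
Proof.
have [x0|x0] := eqVneq (l2_norm x) 0.
  rewrite x0 mulr0.
  have xz i : x i 0 = 0.
    have : \sum_i x i 0 ^+ 2 = 0 by rewrite -l2_norm_sqr x0 expr0n.
    move=> /psumr_eq0P h; apply/eqP; rewrite -sqrf_eq0; apply/eqP/h => // j _.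
    by rewrite exprn_even_ge0.
  have -> : x = 0 by apply/matrixP => i j; rewrite ord1 xz mxE.
  by rewrite mulmx0 /l2_norm big1 ?sqrtr0 // => i _; rewrite mxE expr0n.
have xp : 0 < l2_norm x by rewrite lt_def x0 l2_norm_ge0.
have xi0 : 0 <= (l2_norm x)^-1 by rewrite invr_ge0 ltW.
rewrite -ler_pdivrMr // mulrC -l2_normZ // scalemxAr.
by apply: l2_op_norm_ge; rewrite l2_normZ // mulVf.
Qed.

(** Substituting [x i = sqrt (p i) * c i] turns both weighted sums into Euclidean norms. *)
Lemma spectral_bound n (A : 'M[R]_n) (p : 'I_n -> R) (c : 'I_n -> R) :
  (forall i, 0 <= p i) -> A^T = A ->
  \sum_l p l * (\sum_i p i * A i l * c i) ^+ 2 <=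
  l2_op_norm (\matrix_(i, j) (A i j * Num.sqrt (p i * p j))) ^+ 2 *
    \sum_i p i * c i ^+ 2.
Proof.
move=> p0 symA; set B := \matrix_(i, j) _.
pose x : 'cV[R]_n := \col_i (Num.sqrt (p i) * c i).
have xE : \sum_i p i * c i ^+ 2 = l2_norm x ^+ 2.
  by rewrite l2_norm_sqr; apply: eq_bigr => i _; rewrite mxE exprMn sqr_sqrtr.
have BxE : \sum_l p l * (\sum_i p i * A i l * c i) ^+ 2 = l2_norm (B *m x) ^+ 2.
  rewrite l2_norm_sqr; apply: eq_bigr => l _.
  rewrite -{1}[p l]sqr_sqrtr // -exprMn; congr (_ ^+ 2).
  rewrite mulr_sumr mxE; apply: eq_bigr => i _; rewrite !mxE sqrtrM //.
  rewrite -[in LHS](sqr_sqrtr (p0 i)) -[in RHS]symA mxE; ring.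
rewrite xE BxE -exprMn; apply: lerXn2r; rewrite ?nnegrE ?l2_norm_ge0 //.
  by rewrite mulr_ge0 ?l2_op_norm_ge0 ?l2_norm_ge0.
exact: l2_norm_mulmx_le.
Qed.

End OperatorNorm.

(** * Consequences of a lower bound on the rate *)

Section Rate.
Context (R : realType).
Implicit Types (x y c gam : R) (N : nat).

(** If [y = 0] the conclusion holds whatever value the quotient takes, so the conventions on zero
    denominators do no harm. *)
Lemma ediv_le N c x y : 0 <= c -> 0 <= x -> 0 <= y ->
  (N%:R%:E <= c%:E * (x%:E / y%:E))%E -> N%:R * y <= c * x.
Proof.
move=> c0 x0; rewrite le_eqVlt => /predU1P[<- _|y0].
  by rewrite mulr0 mulr_ge0.
by rewrite inver gt_eqF // -!EFinM lee_fin mulrA ler_pdivlMr.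
Qed.

(** Raising to the power [gam^-1 >= 1] also hits the constant, but for [c <= 1] this only decreases
    it. *)
Lemma ediv_powR_le N c x y gam : 0 <= c <= 1 -> 0 <= x -> 0 <= y -> 0 < gam <= 1 ->
  (N%:R%:E <= c%:E * ((x%:E / y%:E) `^ gam))%E -> N%:R `^ gam^-1 * y <= c * x.
Proof.
move=> /andP[c0 c1] x0 + /andP[g0 g1]; rewrite le_eqVlt => /predU1P[<- _|y0].
  by rewrite mulr0 mulr_ge0.
rewrite inver gt_eqF // -[(x%:E * _)%E]EFinM poweR_EFin -EFinM lee_fin => h.
have d0 : 0 <= x / y by rewrite divr_ge0 // ltW.
have gi : 1 <= gam^-1 by rewrite invf_ge1.
have gi0 : 0 <= gam^-1 by rewrite invr_ge0 ltW.
rewrite -ler_pdivlMr // -mulrA.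
apply: (@le_trans _ _ ((c * (x / y) `^ gam) `^ gam^-1)).
  by apply: ge0_ler_powR; rewrite ?nnegrE // mulr_ge0 ?powR_ge0.
rewrite powRM ?powR_ge0 // -powRrM mulfV ?gt_eqF // powRr1 // ler_wpM2r //.
move: c0; rewrite le_eqVlt => /predU1P[<-|c0].
  by rewrite powR0 // gt_eqF // invr_gt0.
by apply: ge1r_powR => //; rewrite c0.
Qed.

Section Bounds.
Context (n : nat) (alpha : R) (A : 'M[R]_n) (p : 'I_n -> R) (t c : R) (N : nat).
Hypothesis alpha01 : 0 < alpha <= 1.
Hypothesis p01 : forall i, 0 <= p i <= 1.
Hypothesis symA : A^T = A.
Hypothesis t0 : 0 <= t.
Hypothesis c01 : 0 <= c <= 1.
Hypothesis N_rate : (N%:R%:E <= c%:E * hanson_wright_rate alpha A p t)%E.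

Let c0 : 0 <= c. Proof. by have /andP[] := c01. Qed.

Let p0 i : 0 <= p i. Proof. by have /andP[] := p01 i. Qed.

Let variance := \sum_(k < n) A k k ^+ 2 * p k +
    \sum_(i < n) \sum_(j < n | i != j) A i j ^+ 2 * p i * p j.

Let mulc (u v : \bar R) : (u <= v)%E -> (c%:E * u <= c%:E * v)%E.
Proof. by move=> uv; apply: lee_wpmul2l; rewrite ?lee_fin. Qed.

Let variance_ge0 : 0 <= variance.
Proof.
rewrite /variance addr_ge0 // sumr_ge0 // => i _.
  by rewrite mulr_ge0 // exprn_even_ge0.
by rewrite sumr_ge0 // => j _; rewrite mulr_ge0 // mulr_ge0 // exprn_even_ge0.
Qed.

Lemma rate_variance : N%:R * variance <= c * t ^+ 2.
Proof.
apply: ediv_le; rewrite ?exprn_ge0 //.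
by apply: le_trans N_rate _; apply: mulc; rewrite ge_min lexx.
Qed.

(** At [t = 0] the first quotient is 0, even for zero variance because [0 / 0 = 0], so no positive
    [N] lies below the rate. Markov's inequality may then divide by [t ^+ N]. *)
Lemma rate_gt0 : (0 < N)%N -> 0 < t.
Proof.
move=> N0; rewrite lt_def t0 andbT; apply/eqP => t00.
have : (N%:R%:E <= c%:E * ((t ^+ 2)%:E / variance%:E))%E.
  by apply: le_trans N_rate _; apply: mulc; rewrite ge_min lexx.
by rewrite t00 expr0n /= mul0e mule0 lee_fin leNgt ltr0n N0.
Qed.

Lemma rate_spectral :
  N%:R * l2_op_norm (\matrix_(i, j) (A i j * Num.sqrt (p i * p j))) <= c * t.
Proof.
apply: ediv_le; rewrite ?l2_op_norm_ge0 //.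
by apply: le_trans N_rate _; apply: mulc; rewrite !ge_min lexx orbT.
Qed.

Let max0 : 0 <= \big[Num.max/0]_(i < n) Num.sqrt (\sum_(j < n) A i j ^+ 2 * p j).
Proof. exact: bigmax_ge_id. Qed.

Lemma rate_column l : N%:R `^ (alpha^-1 + 2^-1) * Num.sqrt (column p A l) <= c * t.
Proof.
have /andP[a0 a1] := alpha01.
apply: (@le_trans _ _ (N%:R `^ (alpha^-1 + 2^-1) *
  \big[Num.max/0]_(i < n) Num.sqrt (\sum_(j < n) A i j ^+ 2 * p j))).
  rewrite ler_wpM2l ?powR_ge0 //.
  rewrite (_ : column p A l = \sum_(j < n) A l j ^+ 2 * p j).
    exact: (le_bigmax _ (fun i => Num.sqrt (\sum_(j < n) A i j ^+ 2 * p j)) l).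
  by apply: eq_bigr => i _; rewrite mulrC -[in LHS]symA mxE.
have -> : alpha^-1 + 2^-1 = (2 * alpha / (2 + alpha))^-1.
  by field; rewrite !gt_eqF // addr_gt0.
apply: ediv_powR_le => //.
- rewrite divr_gt0 ?mulr_gt0 ?addr_gt0 //= ler_pdivrMr ?addr_gt0 //; lra.
- by apply: le_trans N_rate _; apply: mulc; rewrite !ge_min lexx !orbT.
Qed.

Lemma rate_entry i j : N%:R `^ (2 * alpha^-1) * `|A i j| <= c * t.
Proof.
have /andP[a0 a1] := alpha01.
apply: (@le_trans _ _ (N%:R `^ (2 * alpha^-1) * mx_norm A)).
  rewrite ler_wpM2l ?powR_ge0 // mx_normrE.
  exact: (le_bigmax _ (fun ij : 'I_n * 'I_n => `|A ij.1 ij.2|) (i, j)).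
have -> : 2 * alpha^-1 = (alpha / 2)^-1 by rewrite invf_div.
apply: ediv_powR_le => //.
- by rewrite mx_normrE; exact: bigmax_ge_id.
- by rewrite divr_gt0 //=; lra.
- by apply: le_trans N_rate _; apply: mulc; rewrite !ge_min lexx !orbT.
Qed.

Lemma rate_diag : N%:R * \sum_i p i * A i i ^+ 2 <= c * t ^+ 2.
Proof.
apply: le_trans rate_variance; rewrite ler_wpM2l //.
rewrite /variance (eq_bigr (fun k => A k k ^+ 2 * p k)) => [|k _]; last by rewrite mulrC.
rewrite lerDl sumr_ge0 // => i _; rewrite sumr_ge0 // => j _.
by rewrite mulr_ge0 // mulr_ge0 // exprn_even_ge0.
Qed.

(** On the diagonal the left side carries the square of [p l] and the variance only [p l];
    [p l <= 1] reconciles them. *)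
Lemma rate_total : N%:R * \sum_l p l * column p A l <= c * t ^+ 2.
Proof.
apply: le_trans rate_variance; rewrite ler_wpM2l //.
rewrite /variance -big_split /=; apply: ler_sum => l _.
rewrite /column (bigD1 l) //= mulrDr; apply: lerD.
  rewrite [leRHS](_ : _ = 1 * (p l * A l l ^+ 2)); last by ring.
  apply: ler_wpM2r; first by rewrite mulr_ge0 // exprn_even_ge0.
  by have /andP[] := p01 l.
rewrite mulr_sumr le_eqVlt; apply/orP; left; apply/eqP.
apply: eq_big => i; first by rewrite eq_sym.
by move=> _; rewrite -[in LHS]symA mxE; ring.
Qed.

End Bounds.
End Rate.

(** * Markov's inequality at an admissible order *)

Section Tail.
Context d (T : measurableType d) (R : realType) (P : probability T R).
Context (n : nat) (p : 'I_n -> R) (delta zeta : 'I_n -> {RV P >-> R}) (A : 'M[R]_n).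
Context (alpha L t : R).
Hypothesis alpha0 : 0 < alpha.
Hypothesis alpha1 : alpha <= 1.
Hypothesis delta_p : forall i, bernoulli_rv (p i) (delta i).
Hypothesis delta_ind : mutually_independent delta.
Hypothesis zeta_sub : forall i, sub_exponential alpha (zeta i).
Hypothesis zeta_centered : forall i, ('E_P[zeta i] = 0)%E.
Hypothesis zeta_ind : mutually_independent zeta.
Hypothesis delta_zeta : independent_families delta zeta.
Hypothesis symA : A^T = A.
Hypothesis L0 : 0 < L.
Hypothesis psi_L : forall i, psi_norm alpha (zeta i) < 2 * L.
Hypothesis t0 : 0 <= t.

Let xi w : 'cV[R]_n := \col_(i < n) (delta i w * zeta i w).

Let Q w := quad_form A (xi w).

Let X i := sparse_rv delta L alpha0 zeta_sub i.

Let p01 i : 0 <= p i <= 1. Proof. by have [] := delta_p i. Qed.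

Let quad : moment_rv P := \sum_i \sum_j moment_cst P (A i j) * X i * X j.

Let mean : R := \sum_i A i i * moment_mean (X i ^+ 2).

Let quad_formE (x : 'cV[R]_n) : quad_form A x = \sum_i \sum_j A i j * x i 0 * x j 0.
Proof.
rewrite /quad_form mxE exchange_big /=; apply: eq_bigr => j _.
rewrite mxE mulr_suml; apply: eq_bigr => i _.
by rewrite mxE [x i 0 * _]mulrC.
Qed.

Let quadE w : quad w = \sum_i \sum_j A i j * X i w * X j w.
Proof.
rewrite -[LHS]/(moment_eval w quad) rmorph_sum; apply: eq_bigr => i _.
by rewrite rmorph_sum; apply: eq_bigr => j _; rewrite !rmorphM.
Qed.

Let Xind : moment_independent (@moment_mean _ _ _ P) X.
Proof. exact: sparse_rv_independent. Qed.

Let Xb : moment_bound (@moment_mean _ _ _ P) X p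
  (4 * alpha^-1 `^ alpha^-1) alpha^-1.
Proof. exact: sparse_rv_bound. Qed.

Let quad_mean : moment_mean quad = mean.
Proof.
rewrite /quad raddf_sum; apply: eq_bigr => i _; rewrite raddf_sum (bigD1 i) //=.
rewrite big1 ?addr0 => [|j ji].
  by rewrite -mulrA -expr2 moment_meanZ.
rewrite -mulrA [LHS]moment_meanZ.
rewrite [X in _ * X](_ : _ = moment_mean (X i) * moment_mean (X j)).
  by have [-> _] := Xb i; rewrite mul0r mulr0.
apply: (moment_independentM (io := @moment_cst _ _ _ P) (@moment_meanZ _ _ _ P)
  (@moment_mean1 _ _ _ P) Xind (J := [set i]%SET) (K := [set j]%SET)).
- by rewrite disjoints1 finset.inE eq_sym.
- by apply: poly_in_gen; rewrite finset.inE.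
- by apply: poly_in_gen; rewrite finset.inE.
Qed.

(** Only almost sure, since [delta i] agrees with its selector only where it takes the values 0 and
    1. *)
Let QE : {ae P, forall w, Q w = L ^+ 2 * quad w}.
Proof.
have : {ae P, forall w, forall i, delta i w = 0 \/ delta i w = 1}.
  apply: filter_forall => i; by have [] := delta_p i.
apply: filterS => w dw; rewrite /Q quad_formE quadE mulr_sumr.
apply: eq_bigr => i _; rewrite mulr_sumr; apply: eq_bigr => j _.
have XE k : L * X k w = delta k w * zeta k w.
  rewrite -[X k w]/(L^-1 * \1_[set 1] (delta k w) * zeta k w) indicE.
  have -> : (delta k w \in [set (1 : R)])%:R = delta k w.
    by case: (dw k) => ->; [rewrite memNset //= => /eqP; rewrite eq_sym oner_eq0 | rewrite mem_set].
  by rewrite !mulrA mulfV ?gt_eqF // mul1r.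
by rewrite !mxE -!XE; ring.
Qed.

Let mQ : measurable_fun [set: T] Q.
Proof.
rewrite (_ : Q = fun w => \sum_i \sum_j A i j * (delta i w * zeta i w) * (delta j w * zeta j w)).
  apply: measurable_sum => i; apply: measurable_sum => j.
  by do ![apply: measurable_funM => //].
apply/funext => w; rewrite /Q quad_formE.
by apply: eq_bigr => i _; apply: eq_bigr => j _; rewrite !mxE.
Qed.

Let Q_mean : ('E_P[Q] = (L ^+ 2 * mean)%:E)%E.
Proof.
rewrite unlock -quad_mean -moment_meanZ -moment_meanE.
apply: ae_eq_integral => //.
- exact/measurable_EFinP.
- by apply/measurable_EFinP; exact: moment_rv_measurable.
by apply: filterS QE => w -> _.
Qed.

Lemma hw_event_measurable :
  measurable [set w | ((L ^+ 2 * t)%:E <= `|(Q w)%:E - 'E_P[Q]|)%E].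
Proof.
have mabs : measurable_fun [set: T] (fun w => `|(Q w)%:E - 'E_P[Q]|%E).
  apply: measurableT_comp => //; apply: emeasurable_funB => //.
  exact/measurable_EFinP.
by have := emeasurable_fun_c_infty measurableT mabs (L ^+ 2 * t)%:E; rewrite setTI.
Qed.

Definition hw_constant : R := chaos_constant (4 * alpha^-1 `^ alpha^-1) alpha^-1.

(** Chosen so that [hw_constant * hw_scale <= exp (- 1)], which makes the moment bound decay like
    [exp (- N)]. Its square multiplies the rate: the variance term then gives [(hw_scale * t) ^+ 2]
    exactly, and the other terms use [hw_scale ^+ 2 <= hw_scale]. *)
Definition hw_scale : R := (1 + expR 1 * hw_constant)^-1.

Lemma hw_tail N : (4 %| N)%N -> (0 < N)%N ->
  (N%:R%:E <= (hw_scale ^+ 2)%:E * hanson_wright_rate alpha A p t)%E ->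
  (P [set w | ((L ^+ 2 * t)%:E <= `|(Q w)%:E - 'E_P[Q]|)%E] <=
   (expR (- N%:R))%:E)%E.
Proof.
move=> N4 N0 N_rate.
have K0 : 0 < 4 * alpha^-1 `^ alpha^-1 :> R.
  by rewrite mulr_gt0 // powR_gt0 // invr_gt0.
have beta1 : 1 <= alpha^-1 by rewrite invf_ge1.
have C0 : 0 <= hw_constant by exact: chaos_constant_ge0.
have D1 : 1 <= 1 + expR 1 * hw_constant by rewrite lerDl mulr_ge0 ?expR_ge0.
have D0 : 0 < 1 + expR 1 * hw_constant by exact: lt_le_trans D1.
have k0 : 0 < hw_scale by rewrite invr_gt0.
have k1 : hw_scale <= 1 by rewrite invf_le1.
have kk : hw_scale ^+ 2 <= hw_scale by rewrite expr2 -[leRHS]mul1r ler_wpM2r // ltW.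
have c01 : 0 <= hw_scale ^+ 2 <= 1 by rewrite exprn_ge0 ?(ltW k0) //= (le_trans kk).
have alpha01 : 0 < alpha <= 1 by rewrite alpha0.
have tp := rate_gt0 t0 c01 N_rate N0.
have NR : 0 < N%:R :> R by rewrite ltr0n.
pose tau := hw_scale * t.
have tau0 : 0 <= tau by rewrite mulr_ge0 // ltW.
have ctau : hw_scale ^+ 2 * t <= tau by rewrite ler_wpM2r.
set S := l2_op_norm (\matrix_(i, j) (A i j * Num.sqrt (p i * p j))).
have p0 i : 0 <= p i by have /andP[] := p01 i.
have qN : moment_mean ((quad - moment_cst P mean) ^+ N) <= (hw_constant * tau) ^+ N.
  apply: (@chaos_moment_le _ _ _ (@moment_eval _ _ _ P) (@moment_cst _ _ _ P)
    (@moment_mean _ _ _ P) _ (@moment_meanZ _ _ _ P) (@moment_mean1 _ _ _ P)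
    (@moment_mean_ge0 _ _ _ P) _ X p _ _ A p01 K0 beta1 Xind Xb _ N tau (S ^+ 2)) => //.
  - by move=> i j; rewrite -[in LHS]symA mxE.
  - by rewrite exprn_ge0 // l2_op_norm_ge0.
  - by move=> c; exact: spectral_bound.
  - by apply: le_trans (rate_diag p01 t0 c01 N_rate) _; rewrite exprMn.
  - by apply: le_trans (rate_total p01 symA t0 c01 N_rate) _; rewrite exprMn.
  - rewrite -exprMn; apply: lerXn2r; rewrite ?nnegrE //.
      by rewrite mulr_ge0 ?l2_op_norm_ge0.
    exact: le_trans (rate_spectral t0 c01 N_rate) ctau.
  - move=> l; have h := le_trans (rate_column alpha01 symA t0 c01 N_rate l) ctau.
    have col0 : 0 <= column p A l.
      by apply: sumr_ge0 => i _; rewrite mulr_ge0 // exprn_even_ge0.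
    have -> : N%:R `^ (2 * alpha^-1) * N%:R * column p A l =
        (N%:R `^ (alpha^-1 + 2^-1) * Num.sqrt (column p A l)) ^+ 2.
      rewrite exprMn sqr_sqrtr // powR_sqr mulrDr mulfV // powRD ?powRr1 ?(ltW NR) //.
      by apply/implyP => _; rewrite gt_eqF.
    by apply: lerXn2r; rewrite ?nnegrE.
  - move=> i j.
    exact: le_trans (rate_entry alpha01 t0 c01 N_rate i j) ctau.
have evenN : ~~ odd N by rewrite -dvdn2; apply: dvdn_trans N4.
set Bad := [set w | _]; pose q := quad - moment_cst P mean.
have mBad : measurable Bad by exact: hw_event_measurable.
have tN0 : 0 < t ^+ N by rewrite exprn_gt0.
apply: (@le_trans _ _ (\int[P]_w (t ^- N * (q ^+ N) w)%:E)%E).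
  have -> : P Bad = (\int[P]_w (\1_Bad w)%:E)%E by rewrite integral_indic // setIT.
  apply: ae_ge0_le_integral => //.
  - by apply/measurable_EFinP; exact: measurable_indic.
  - move=> w _; rewrite lee_fin moment_rvX mulr_ge0 ?invr_ge0 ?(ltW tN0) //.
    by rewrite exprn_even_ge0.
  - apply/measurable_EFinP; apply: measurable_funM => //; exact: moment_rv_measurable.
  apply: filterS QE => w Qw _; rewrite lee_fin indicE moment_rvX.
  have qN0 : 0 <= t ^- N * q w ^+ N.
    by rewrite mulr_ge0 ?invr_ge0 ?(ltW tN0) // exprn_even_ge0.
  have [|_ //] := boolP (w \in Bad); rewrite inE /Bad /= Q_mean -EFinB abse_EFin lee_fin.
  rewrite Qw -mulrBr normrM ger0_norm ?exprn_ge0 ?(ltW L0) // ler_pM2l ?exprn_gt0 // => tq.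
  rewrite ler_pdivlMl // mulr1.
  have -> : q w ^+ N = `|q w| ^+ N by rewrite -normrX ger0_norm // exprn_even_ge0.
  by apply: lerXn2r; rewrite ?nnegrE.
under eq_integral do rewrite EFinM.
rewrite ge0_integralZl //; last first.
- by rewrite lee_fin invr_ge0 ltW.
- by move=> w _; rewrite lee_fin moment_rvX exprn_even_ge0.
- by apply/measurable_EFinP; exact: moment_rv_measurable.
rewrite moment_meanE -EFinM lee_fin.
apply: (@le_trans _ _ (t ^- N * (hw_constant * tau) ^+ N)).
  by rewrite ler_wpM2l // invr_ge0 ltW.
have -> : t ^- N * (hw_constant * tau) ^+ N = (hw_constant * hw_scale) ^+ N.
  rewrite -exprVn -exprMn /tau; congr (_ ^+ N); field; rewrite gt_eqF //.
have -> : expR (- N%:R) = expR (- 1) ^+ N :> R by rewrite -expRM_natr mulN1r.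
apply: lerXn2r; rewrite ?nnegrE ?expR_ge0 //.
  by rewrite mulr_ge0 // ltW.
rewrite /hw_scale ler_pdivrMr // mulrDr mulr1 mulrA expRN mulVf ?gt_eqF ?expR_gt0 //.
by rewrite mul1r lerDr invr_ge0 expR_ge0.
Qed.

End Tail.

(** * From multiples of 4 to an arbitrary rate *)

Section Conclusion.
Context (R : realType).

Lemma expR_tail_le (x c : R) (r : \bar R) : 0 < c ->
  x <= 1 ->
  (forall N, (4 %| N)%N -> (0 < N)%N -> (N%:R%:E <= c%:E * r)%E -> x <= expR (- N%:R)) ->
  (x%:E <= 2%:E * expeR (- ((c / 8)%:E * r)))%E.
Proof.
move=> c0 x1 tail; have c8 : 0 < c / 8 by rewrite divr_gt0.
case: r tail => [r| |] tail.
- change (x%:E <= (2 * expR (- (c / 8 * r)))%:E)%E; rewrite lee_fin.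
  (* Below 4 no admissible order exists, and the trivial bound suffices: the divisor 8 makes the
     exponent at most [1 / 2], so the right side is at least [2 * (1 - 1 / 2) = 1]. Above 4,
     rounding down to [4 * m] costs at most a factor 2. *)
  have [small|large] := ltP (c * r) 4.
    apply: le_trans x1 _.
    have := expR_ge1Dx (- (c / 8 * r)).
    have : c / 8 * r <= 2^-1 by rewrite mulrAC ler_pdivrMr //; lra.
    lra.
  pose m := Num.truncn (c * r / 4).
  have cr4 : 1 <= c * r / 4 by rewrite ler_pdivlMr // mul1r.
  have /andP[mle mlt] := Num.Theory.truncn_itv (le_trans ler01 cr4).
  have m0 : (0 < m)%N by rewrite /m truncn_gt0.
  have mR : 1 <= m%:R :> R by rewrite ler1n.
  have le_N : (4 * m)%:R <= c * r by rewrite natrM mulrC -ler_pdivlMr.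
  have := tail (4 * m)%N; rewrite dvdn_mulr // muln_gt0 m0 -EFinM lee_fin le_N.
  move=> /(_ isT isT isT) /le_trans; apply.
  apply: (@le_trans _ _ (expR (- (c / 8 * r)))); last first.
    by rewrite ler_peMl ?expR_ge0 // ler1n.
  rewrite ler_expR lerN2 natrM.
  have crm : c * r < (m%:R + 1) * 4 by rewrite natr1 -ltr_pdivrMr.
  rewrite mulrAC ler_pdivrMr //; move: (c * r) crm => y; lra.
- rewrite gt0_muley ?lte_fin //= mule0 lee_fin leNgt; apply/negP => x0.
  (* For an infinite rate every order is admissible; a positive [x] is contradicted as soon as the
     order exceeds its inverse. *)
  pose m := (Num.truncn x^-1).+1.
  have := tail (4 * m)%N; rewrite dvdn_mulr // muln_gt0 /= gt0_muley ?lte_fin // leey.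
  move=> /(_ isT isT isT); rewrite leNgt => /negP; apply.
  rewrite expRN invf_plt ?posrE ?expR_gt0 //.
  apply: lt_le_trans (truncnS_gt x^-1) _.
  apply: le_trans (expR_ge1Dx _).
  have : m%:R <= (4 * m)%:R :> R by rewrite ler_nat leq_pmull.
  rewrite -/m; lra.
- by rewrite gt0_muleNy ?lte_fin //= gt0_muley ?lte_fin // leey.
Qed.

End Conclusion.

Theorem theorem2 (R : realType) (alpha : R) (alpha_gt0 : 0 < alpha)
    (alpha_le1 : alpha <= 1) :
  exists2 c : R, 0 < c &
    forall (d : measure_display) (T : measurableType d) (P : probability T R)
      (n : nat) (p : 'I_n -> R) (delta zeta : 'I_n -> {RV P >-> R})
      (A : 'M[R]_n),
    let xi := fun w : T => \col_(i < n) (delta i w * zeta i w) in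
    let Q := fun w : T => quad_form A (xi w) in
    let L := \big[Num.max/0]_(i < n) psi_norm alpha (zeta i) in
    (0 < n)%N ->
    (forall i, bernoulli_rv (p i) (delta i)) ->
    mutually_independent delta ->
    (forall i, sub_exponential alpha (zeta i)) ->
    (forall i, ('E_P[zeta i] = 0)%E) ->
    mutually_independent zeta ->
    independent_families delta zeta ->
    A^T = A ->
    0 < L ->
    forall t : R, 0 <= t ->
      (P [set w | ((L ^+ 2 * t)%:E <= `|(Q w)%:E - 'E_P[Q]|)%E]
       <= 2%:E * expeR (- (c%:E * hanson_wright_rate alpha A p t)))%E.
Proof.
have scale0 : 0 < hw_scale alpha.
  rewrite invr_gt0 ltr_pwDl // mulr_ge0 ?expR_ge0 //.
  by apply: chaos_constant_ge0; rewrite mulr_gt0 // powR_gt0 // invr_gt0.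
have scale2 : 0 < hw_scale alpha ^+ 2 by rewrite exprn_gt0.
exists (hw_scale alpha ^+ 2 / 8); first by rewrite divr_gt0.
move=> d T P n p delta zeta A xi Q L _ delta_p delta_ind zeta_sub zeta_centered
  zeta_ind delta_zeta symA L0 t t0.
have psi_L i : psi_norm alpha (zeta i) < 2 * L.
  apply: (@le_lt_trans _ _ L); last by rewrite ltr_pMl // ltr1n.
  exact: (le_bigmax _ (fun i => psi_norm alpha (zeta i)) i).
have tail := hw_tail alpha_gt0 alpha_le1 delta_p delta_ind zeta_sub zeta_centered
  zeta_ind delta_zeta symA L0 psi_L t0.
have mBad := hw_event_measurable delta zeta A L t.
rewrite -[X in (X <= _)%E]fineK ?fin_num_measure //.
apply: expR_tail_le => //.
  by rewrite -lee_fin fineK ?fin_num_measure // probability_le1.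
by move=> N N4 N0 hN; rewrite -lee_fin fineK ?fin_num_measure // tail.
Qed.
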